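(* If $f \in \mathcal{S}^*_{\rho}$, then the following results hold: (i) For $1-\sinh^{-1}(1)\leq\alpha<1$, $f \in \mathcal{S}^*_{\alpha}$ in $|z| \leq \sinh(1-\alpha)$. (ii) For $1<\beta\leq 1+\sinh^{-1}(1)$, $f \in M(\beta)$ in $|z| \leq \sinh(\beta-1)$. (iii) For $k>0$, $f \in k\text{-}\mathcal{ST}$ in $|z| \leq \sinh(1/(k+1))$. The results are sharp, i.e. none of the three radii can be replaced by a larger number in $(0,1]$ for which the respective statement still holds for all $f\in\mathcal{S}^*_\rho$.
   Context: $\mathbb{D}=\{z\in\mathbb{C}:|z|<1\}$. $\mathcal{A}$ is the class of analytic functions $f$ on $\mathbb{D}$ with $f(z)=z+a_2z^2+a_3z^3+\cdots$; $\mathcal{S}\subset\mathcal{A}$ is the subclass of univalent functions. For analytic $g,h$ on $\mathbb{D}$, $g\prec h$ (subordination) means $g=h\circ\omega$ for some analytic $\omega$ on $\mathbb{D}$ with $\omega(0)=0$ and $|\omega(z)|\le|z|$. $\sinh^{-1}(z)=\ln(z+\sqrt{1+z^2})$ is the principal branch (analytic in $\mathbb{D}$, $\sinh^{-1}(0)=0$). $\mathcal{S}^*_{\rho}=\{f\in\mathcal{A}: zf'(z)/f(z)\prec 1+\sinh^{-1}(z)\}$. For $0\le\alpha<1$, $\mathcal{S}^*_\alpha=\{f\in\mathcal{S}: zf'(z)/f(z)\prec (1+(1-2\alpha)z)/(1-z)\}$. For $\beta>1$, $M(\beta)=\{f\in\mathcal{A}:\operatorname{Re}(zf'(z)/f(z))<\beta,\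 z\in\mathbb{D}\}$. For $k\ge0$, $k\text{-}\mathcal{ST}=\{f\in\mathcal{A}:\operatorname{Re}(zf'(z)/f(z))>k\,|zf'(z)/f(z)-1|,\ z\in\mathbb{D}\}$. For a subclass $\mathcal{G}\subset\mathcal{A}$ and $0<r_0\le1$, ''$f\in\mathcal{G}$ in $|z|\le r_0$'' means that the function $z\mapsto r^{-1}f(rz)$ on $\mathbb{D}$ belongs to $\mathcal{G}$ for every $0<r\le r_0$.
   Formalization: In (iii), for small k the number sinh(1/(k+1)) exceeds 1, where ''in |z| ≤ r_0'' is undefined; the radius is then read as 1 (all 0<r≤1), and sharpness for such k is empty, as no larger number in (0,1] exists. *)

(* Defs.v *)
From Stdlib Require Import Reals Lra.
From Coquelicot Require Import Coquelicot.
Open Scope R_scope.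

(** * Principal branches *)

Definition Cexp (z : C) : C := (exp (Re z) * cos (Im z), exp (Re z) * sin (Im z)).

(* Principal argument in (-PI, PI].  Off the closed negative real axis this is
   the half-angle formula arg (x + i y) = 2 atan (y / (|z| + x)).
   The value at 0 is irrelevant. *)
Definition Carg (z : C) : R :=
  match Req_EM_T (Im z) 0, Rlt_dec (Re z) 0 with
  | left _, left _ => PI
  | _, _ => 2 * atan (Im z / (Cmod z + Re z))
  end.

Definition Clog (z : C) : C := (ln (Cmod z), Carg z).

Definition Csqrt (z : C) : C :=
  if Ceq_dec z 0 then RtoC 0 else Cexp (Clog z / 2)%C.

Definition Casinh (z : C) : C := Clog (z + Csqrt (1 + z * z))%C.

(** [Clog] is the principal logarithm. *)
Lemma Clog_principal (z : C) :
  z <> 0%C -> Cexp (Clog z) = z /\ - PI < Im (Clog z) <= PI.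
Proof.
intros Hz.
assert (Hm : 0 < Cmod z) by (apply Cmod_gt_0; exact Hz).
assert (Hsq : Cmod z * Cmod z = Re z * Re z + Im z * Im z).
{ unfold Cmod, Re, Im. rewrite sqrt_sqrt; [ring | nra]. }
unfold Cexp, Clog; simpl; rewrite (exp_ln _ Hm).
assert (HPI := PI_RGT_0).
unfold Carg.
assert (Hmain : 0 < Cmod z + Re z ->
  (Cmod z * cos (2 * atan (Im z / (Cmod z + Re z))),
   Cmod z * sin (2 * atan (Im z / (Cmod z + Re z)))) = z /\
  - PI < 2 * atan (Im z / (Cmod z + Re z)) <= PI).
{ intros Hd. set (t := Im z / (Cmod z + Re z)).
  assert (Hb := atan_bound t). split; [| lra].
  assert (H1 : 0 < 1 + t * t) by nra.
  assert (Hs : sqrt (1 + Rsqr t) * sqrt (1 + Rsqr t) = 1 + t * t).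
  { rewrite sqrt_sqrt; unfold Rsqr; lra. }
  assert (Hs0 : sqrt (1 + Rsqr t) <> 0) by (intro E; rewrite E in Hs; lra).
  assert (Hc : cos (2 * atan t) = (1 - t * t) / (1 + t * t)).
  { rewrite cos_2a, cos_atan, sin_atan, <- Hs. field. exact Hs0. }
  assert (Hn : sin (2 * atan t) = 2 * t / (1 + t * t)).
  { rewrite sin_2a, cos_atan, sin_atan, <- Hs. field. exact Hs0. }
  rewrite Hc, Hn.
  assert (Ht : t * (Cmod z + Re z) = Im z) by (unfold t; field; lra).
  assert (H2 : (1 + t * t) * (Cmod z + Re z) = 2 * Cmod z).
  { apply Rmult_eq_reg_r with (Cmod z + Re z); [| lra].
    replace ((1 + t * t) * (Cmod z + Re z) * (Cmod z + Re z))
      with ((Cmod z + Re z) * (Cmod z + Re z)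
            + (t * (Cmod z + Re z)) * (t * (Cmod z + Re z))) by ring.
    rewrite Ht. lra. }
  assert (E1 : Cmod z * ((1 - t * t) / (1 + t * t)) = Re z).
  { replace (Re z) with ((1 - t * t) * (2 * Cmod z) / (2 * (1 + t * t)));
      [field; lra |].
    rewrite <- H2.
    replace (Re z) with (Cmod z + Re z - Cmod z) at 2 by ring.
    replace (Cmod z) with ((1 + t * t) * (Cmod z + Re z) / 2) at 3 by lra.
    field; lra. }
  assert (E2 : Cmod z * (2 * t / (1 + t * t)) = Im z).
  { replace (Cmod z) with ((1 + t * t) * (Cmod z + Re z) / 2) by lra.
    rewrite <- Ht. field. lra. }
  rewrite E1, E2. destruct z; reflexivity. }
destruct (Req_EM_T (Im z) 0) as [Hi | Hi];
  [destruct (Rlt_dec (Re z) 0) as [Hr | Hr] |].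
- split; [| lra]. rewrite cos_PI, sin_PI.
  assert (Cmod z = - Re z) by nra.
  rewrite H. destruct z as [x y]; unfold Re, Im in *; simpl in *; subst y.
  apply injective_projections; simpl; ring.
- apply Hmain; lra.
- apply Hmain. assert (0 < Im z * Im z) by nra. nra.
Qed.

(** * Function classes on the unit disc

    Functions are total maps [C -> C]; only their values on the open unit disc
    matter. *)

Definition analytic_D (f : C -> C) : Prop :=
  forall z : C, Cmod z < 1 -> ex_derive f z.

Definition class_A (f : C -> C) : Prop :=
  analytic_D f /\
  exists a : nat -> C, a 0%nat = RtoC 0 /\ a 1%nat = RtoC 1 /\
    forall z : C, Cmod z < 1 -> is_pseries a z (f z).

Definition class_S (f : C -> C) : Prop :=
  class_A f /\
  forall z w : C, Cmod z < 1 -> Cmod w < 1 -> f z = f w -> z = w.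

Definition subordinate (g h : C -> C) : Prop :=
  exists w : C -> C, analytic_D w /\ w 0%C = 0%C /\
    (forall z : C, Cmod z < 1 -> Cmod (w z) <= Cmod z) /\
    (forall z : C, Cmod z < 1 -> g z = h (w z)).

(* z f'(z) / f(z), with its limit 1 at the removable singularity z = 0. *)
Definition zdlog (f : C -> C) (z : C) : C :=
  if Ceq_dec z 0 then RtoC 1 else (z * C_derive f z / f z)%C.

(* For f in [class_A], z f'(z) / f(z) has a pole at every zero z <> 0 of f, so
   any condition on this quotient throughout the disc presupposes that there
   are none.  Division in [C] being total, this has to be said explicitly. *)
Definition zdlog_defined (f : C -> C) : Prop :=
  forall z : C, Cmod z < 1 -> z <> 0%C -> f z <> 0%C.

Definition class_S_rho (f : C -> C) : Prop :=
  class_A f /\ zdlog_defined f /\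
  subordinate (zdlog f) (fun z => (1 + Casinh z)%C).

Definition class_S_star (alpha : R) (f : C -> C) : Prop :=
  class_S f /\ zdlog_defined f /\
  subordinate (zdlog f) (fun z => ((1 + RtoC (1 - 2 * alpha) * z) / (1 - z))%C).

Definition class_M (beta : R) (f : C -> C) : Prop :=
  class_A f /\ zdlog_defined f /\
  forall z : C, Cmod z < 1 -> Re (zdlog f z) < beta.

Definition class_kST (k : R) (f : C -> C) : Prop :=
  class_A f /\ zdlog_defined f /\
  forall z : C, Cmod z < 1 -> Re (zdlog f z) > k * Cmod (zdlog f z - 1)%C.

(* "f in G in |z| <= r0".  The bound r <= 1 only matters when r0 > 1: functions
   being defined on the unit disc only, the property then means the same as
   for r0 = 1. *)
Definition in_disc (G : (C -> C) -> Prop) (f : C -> C) (r0 : R) : Prop :=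
  forall r : R, 0 < r -> r <= r0 -> r <= 1 ->
    G (fun z => (/ RtoC r * f (RtoC r * z))%C).

(* [r0] cannot be replaced by a larger number in (0, 1]. *)
Definition sharp_radius (F G : (C -> C) -> Prop) (r0 : R) : Prop :=
  forall r1 : R, r0 < r1 -> 0 < r1 <= 1 ->
    ~ (forall f : C -> C, F f -> in_disc G f r1).

(* Main.v *)
Require Import Defs.
From Stdlib Require Import Reals Lra Lia Psatz.
From Coquelicot Require Import Coquelicot.
Open Scope R_scope.

(* Write p = z f'/f = 1 + asinh (w (z)) with |w (z)| <= |z|.  If sinh (a + i b) = w
   then |w|^2 = sinh^2 a + sin^2 b, and |b| < PI/2 on the disc.  Hence
   |Re asinh w| <= arcsinh |w|, which gives the bounds Re p > alpha and
   Re p < beta; the conic condition and the Schwarz-type bound needed for the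
   subordination to the half-plane map reduce to explicit inequalities in a, b.

   Univalence: f(z)/z stays in the right half-plane, hence has a logarithm, and
   log f, as a function of log z, is a function on the left half-plane whose
   derivative p has positive real part.

   Sharpness: the function with w (z) = z, namely z exp (int_0^z asinh t / t dt),
   is given by its power series, and p is evaluated at real points.  *)

(** * Complex differentiability *)

(** Subordination asks for a witness omega with |omega(z)| <= |z|, usually supplied by the Schwarz
    lemma. Here the witness is explicit: solving the half-plane map for the value p = 1 + s, with d
    = 1 - alpha, gives s / (s + 2 d), and the bound follows from the pointwise inequality |s| sinh d
    <= |sinh s| |s + 2 d| together with |sinh s| = |w(r z)| <= r |z| <= |z| sinh d. Both explicit
    inequalities, for the half-plane and for the conic, become equalities at s = -d, the value that
    the extremal function approaches as z tends to -1. So the dependence on Re s is treated exactly,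
    by concavity or factorisation, and only the terms in Im s leave room for decimal constants.
    Membership in [class_S_star] includes univalence, so it has to be derived from Re p > 0. No
    contour integral occurs: a primitive is either a [Clog] of a function with values in the right
    half-plane or a power series integrated termwise, and two holomorphic functions are identified
    by a vanishing derivative along segments from 0. *)

Definition ccont (f : C -> C) (z : C) : Prop :=
  forall eps : R, 0 < eps -> exists d : R, 0 < d /\
    forall w : C, Cmod (w - z) < d -> Cmod (f w - f z) < eps.

(* Caratheodory's form of complex differentiability: the sum, product, chain
   and inverse rules reduce to algebra of continuous functions. *)
Definition cdiff (f : C -> C) (z l : C) : Prop :=
  exists phi : C -> C, ccont phi z /\ phi z = l /\
    forall w : C, f w = (f z + phi w * (w - z))%C.

Lemma Cmod_self (z : C) : Cmod (z - z) = 0.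
Proof. replace (z - z)%C with (RtoC 0) by ring. apply Cmod_0. Qed.

Lemma Cminus_eq_of_plus (x y c : C) : x = (y + c)%C -> (x - y)%C = c.
Proof. intros ->. ring. Qed.

Lemma ccont_const (c z : C) : ccont (fun _ => c) z.
Proof. intros e He. exists 1. split; [lra|]. intros w _. rewrite Cmod_self. exact He. Qed.

Lemma ccont_id (z : C) : ccont (fun w => w) z.
Proof. intros e He. exists e. split; [exact He|]. intros w Hw. exact Hw. Qed.

Lemma ccont_plus (f g : C -> C) (z : C) :
  ccont f z -> ccont g z -> ccont (fun w => f w + g w)%C z.
Proof.
intros Hf Hg e He.
destruct (Hf (e/2)) as [d1 [Hd1 H1]]; [lra|].
destruct (Hg (e/2)) as [d2 [Hd2 H2]]; [lra|].
exists (Rmin d1 d2). split; [apply Rmin_pos; assumption|].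
intros w Hw.
assert (A1 := H1 w (Rlt_le_trans _ _ _ Hw (Rmin_l _ _))).
assert (A2 := H2 w (Rlt_le_trans _ _ _ Hw (Rmin_r _ _))).
replace (f w + g w - (f z + g z))%C with ((f w - f z) + (g w - g z))%C by ring.
eapply Rle_lt_trans; [apply Cmod_triangle|lra].
Qed.

Lemma ccont_mult (f g : C -> C) (z : C) :
  ccont f z -> ccont g z -> ccont (fun w => f w * g w)%C z.
Proof.
intros Hf Hg e He.
assert (Ff := Cmod_ge_0 (f z)). assert (Fg := Cmod_ge_0 (g z)).
(* For e' <= 1 the error of the product is at most e' e' + e' (|f z| + |g z|) <= e' K. *)
set (K := Cmod (f z) + Cmod (g z) + 1).
assert (HK : 1 <= K) by (unfold K; lra).
set (e' := Rmin 1 (e / K)).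
assert (He' : 0 < e').
{ apply Rmin_pos; [lra|]. apply Rdiv_lt_0_compat; lra. }
destruct (Hf e' He') as [d1 [Hd1 H1]].
destruct (Hg e' He') as [d2 [Hd2 H2]].
exists (Rmin d1 d2). split; [apply Rmin_pos; assumption|].
intros w Hw.
assert (A1 := H1 w (Rlt_le_trans _ _ _ Hw (Rmin_l _ _))).
assert (A2 := H2 w (Rlt_le_trans _ _ _ Hw (Rmin_r _ _))).
replace (f w * g w - f z * g z)%C with
  ((f w - f z) * (g w - g z) + (f z * (g w - g z) + (f w - f z) * g z))%C by ring.
eapply Rle_lt_trans; [apply Cmod_triangle|].
eapply Rle_lt_trans; [apply Rplus_le_compat_l, Cmod_triangle|].
rewrite !Cmod_mult.
assert (B1 : e' <= 1) by apply Rmin_l.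
assert (B2 : e' * K <= e).
{ apply Rle_trans with (e / K * K); [apply Rmult_le_compat_r; [lra|apply Rmin_r]|].
  right. field. lra. }
unfold K in B2.
assert (C1 := Cmod_ge_0 (f w - f z)%C). assert (C2 := Cmod_ge_0 (g w - g z)%C).
nra.
Qed.

Lemma ccont_comp (f g : C -> C) (z : C) :
  ccont g z -> ccont f (g z) -> ccont (fun w => f (g w)) z.
Proof.
intros Hg Hf e He. destruct (Hf e He) as [d1 [Hd1 H1]].
destruct (Hg d1 Hd1) as [d [Hd H]]. exists d. split; [exact Hd|].
intros w Hw. apply H1, H, Hw.
Qed.

Lemma ccont_inv (f : C -> C) (z : C) :
  ccont f z -> f z <> 0%C -> ccont (fun w => / f w)%C z.
Proof.
intros Hf Hz e He. apply Cmod_gt_0 in Hz. set (m := Cmod (f z)) in *.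
destruct (Hf (Rmin (m/2) (e * (m * m) / 2))) as [d [Hd H]].
{ apply Rmin_pos; [lra|]. assert (0 < m * m) by nra.
  assert (0 < e * (m*m)) by nra. lra. }
exists d. split; [exact Hd|]. intros w Hw. specialize (H w Hw).
assert (H1 := Rlt_le_trans _ _ _ H (Rmin_l _ _)).
assert (H2 := Rlt_le_trans _ _ _ H (Rmin_r _ _)).
assert (H3 : m / 2 < Cmod (f w)).
{ assert (T := Cmod_triangle (f w) (- (f w - f z))%C).
  replace (f w + - (f w - f z))%C with (f z) in T by ring.
  rewrite Cmod_opp in T. fold m in T. lra. }
assert (N1 : f w <> 0%C) by (apply Cmod_gt_0; lra).
assert (N2 : f z <> 0%C) by (apply Cmod_gt_0; fold m; lra).
replace (/ f w - / f z)%C with (- (f w - f z) * / (f w * f z))%C by (field; auto).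
rewrite Cmod_mult, Cmod_opp, Cmod_inv, Cmod_mult by (apply Cmult_neq_0; auto).
fold m. apply Rmult_lt_reg_r with (Cmod (f w) * m); [nra|].
rewrite Rmult_assoc, Rinv_l by nra. rewrite Rmult_1_r.
eapply Rlt_trans; [exact H2|].
assert (m / 2 * m < Cmod (f w) * m) by nra. nra.
Qed.

Lemma ccont_ext_loc (f g : C -> C) (z : C) (d : R) :
  0 < d -> (forall w, Cmod (w - z) < d -> f w = g w) -> ccont f z -> ccont g z.
Proof.
intros Hd He Hf e Hpe. destruct (Hf e Hpe) as [d1 [Hd1 H1]].
exists (Rmin d d1). split; [apply Rmin_pos; assumption|]. intros w Hw.
rewrite <- (He w), <- (He z).
- apply H1. eapply Rlt_le_trans; [exact Hw|apply Rmin_r].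
- rewrite Cmod_self. exact Hd.
- eapply Rlt_le_trans; [exact Hw|apply Rmin_l].
Qed.

Lemma cdiff_ccont (f : C -> C) (z l : C) : cdiff f z l -> ccont f z.
Proof.
intros [phi [Hc [_ He]]].
apply ccont_ext_loc with (fun w => f z + phi w * (w - z))%C 1; [lra| |].
{ intros w _. symmetry. apply He. }
apply ccont_plus; [apply ccont_const|]. apply ccont_mult; [exact Hc|].
apply ccont_plus; [apply ccont_id|apply ccont_const].
Qed.

Lemma cdiff_const (c z : C) : cdiff (fun _ => c) z 0.
Proof.
exists (fun _ => RtoC 0). split; [apply ccont_const|]. split; [reflexivity|]. intros w. ring.
Qed.

Lemma cdiff_id (z : C) : cdiff (fun w => w) z 1.
Proof.
exists (fun _ => RtoC 1). split; [apply ccont_const|]. split; [reflexivity|]. intros w. ring.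
Qed.

Lemma cdiff_plus (f g : C -> C) (z a b : C) :
  cdiff f z a -> cdiff g z b -> cdiff (fun w => f w + g w)%C z (a + b)%C.
Proof.
intros [p [P1 [P2 P3]]] [q [Q1 [Q2 Q3]]].
exists (fun w => p w + q w)%C. split; [apply ccont_plus; assumption|].
split; [rewrite P2, Q2; reflexivity|]. intros w. rewrite P3, Q3. ring.
Qed.

Lemma cdiff_mult (f g : C -> C) (z a b : C) :
  cdiff f z a -> cdiff g z b -> cdiff (fun w => f w * g w)%C z (a * g z + f z * b)%C.
Proof.
intros Hf Hg. assert (Cg := cdiff_ccont _ _ _ Hg).
destruct Hf as [p [P1 [P2 P3]]]. destruct Hg as [q [Q1 [Q2 Q3]]].
exists (fun w => p w * g w + f z * q w)%C. split.
- apply ccont_plus; apply ccont_mult; auto using ccont_const.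
- split; [rewrite P2, Q2; reflexivity|]. intros w. rewrite (P3 w), (Q3 w). ring.
Qed.

Lemma cdiff_comp (f g : C -> C) (z a b : C) :
  cdiff f (g z) a -> cdiff g z b -> cdiff (fun w => f (g w)) z (a * b)%C.
Proof.
intros Hf Hg. assert (Cg := cdiff_ccont _ _ _ Hg).
destruct Hf as [p [P1 [P2 P3]]]. destruct Hg as [q [Q1 [Q2 Q3]]].
exists (fun w => p (g w) * q w)%C. split.
- apply ccont_mult; [apply (ccont_comp p g)|]; assumption.
- split; [rewrite P2, Q2; reflexivity|]. intros w. rewrite (P3 (g w)), (Q3 w). ring.
Qed.

Lemma ccont_neq_0 (f : C -> C) (z : C) :
  ccont f z -> f z <> 0%C ->
  exists d, 0 < d /\ forall w, Cmod (w - z) < d -> f w <> 0%C.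
Proof.
intros Hf Hz. apply Cmod_gt_0 in Hz.
destruct (Hf _ Hz) as [d [Hd H]]. exists d. split; [exact Hd|].
intros w Hw E. specialize (H w Hw). rewrite E in H.
replace (0 - f z)%C with (- f z)%C in H by ring. rewrite Cmod_opp in H. lra.
Qed.

(** [cdiff] demands its identity for every w, so away from z the slope function is replaced by the
    plain difference quotient, which satisfies it trivially and does not affect continuity at z. *)
Lemma cdiff_of_loc (f phi : C -> C) (z : C) (d : R) :
  0 < d -> ccont phi z ->
  (forall w, Cmod (w - z) < d -> f w = (f z + phi w * (w - z))%C) ->
  cdiff f z (phi z).
Proof.
intros Hd Hc He.
exists (fun w => if Rlt_dec (Cmod (w - z)) d then phi w else ((f w - f z) / (w - z))%C).
split; [|split].
- apply ccont_ext_loc with phi d; [exact Hd| |exact Hc].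
  intros w Hw. destruct (Rlt_dec _ _); [reflexivity|contradiction].
- destruct (Rlt_dec _ _) as [|n]; [reflexivity|].
  exfalso. apply n. rewrite Cmod_self. exact Hd.
- intros w. destruct (Rlt_dec _ _) as [l|n]; [apply He, l|].
  field. intros E. apply n. rewrite E, Cmod_0. exact Hd.
Qed.

Lemma cdiff_ext_loc (f g : C -> C) (z l : C) (d : R) :
  0 < d -> (forall w, Cmod (w - z) < d -> f w = g w) -> cdiff f z l -> cdiff g z l.
Proof.
intros Hd He [p [P1 [P2 P3]]]. rewrite <- P2. apply cdiff_of_loc with d; [exact Hd|exact P1|].
intros w Hw. rewrite <- (He w Hw), <- (He z); [apply P3|]. rewrite Cmod_self. exact Hd.
Qed.

Lemma cdiff_inv (f : C -> C) (z a : C) :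
  cdiff f z a -> f z <> 0%C -> cdiff (fun w => / f w)%C z (- a / (f z * f z))%C.
Proof.
intros Hf Hz. assert (Cf := cdiff_ccont _ _ _ Hf).
destruct (ccont_neq_0 f z Cf Hz) as [d [Hd H]].
destruct Hf as [p [P1 [P2 P3]]].
replace (- a / (f z * f z))%C with ((fun w => - (1) * p w * / (f w * f z)) z)%C
  by (rewrite P2; field; exact Hz).
apply (cdiff_of_loc _ (fun w => - (1) * p w * / (f w * f z))%C z d); [exact Hd| |].
- apply (ccont_mult (fun w => - (1) * p w)%C (fun w => / (f w * f z))%C).
  + apply (ccont_mult (fun _ => - (1))%C p); [apply ccont_const|exact P1].
  + apply (ccont_inv (fun w => f w * f z)%C).
    * apply (ccont_mult f (fun _ => f z)); [exact Cf|apply ccont_const].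
    * apply Cmult_neq_0; exact Hz.
- intros w Hw. specialize (H w Hw). assert (E := P3 w).
  replace (- (1) * p w * / (f w * f z) * (w - z))%C
    with (- (p w * (w - z)) / (f w * f z))%C by (field; auto).
  rewrite <- (Cminus_eq_of_plus _ _ _ E).
  field; auto.
Qed.

Lemma cdiff_div (f g : C -> C) (z a b : C) :
  cdiff f z a -> cdiff g z b -> g z <> 0%C ->
  cdiff (fun w => f w / g w)%C z ((a * g z - f z * b) / (g z * g z))%C.
Proof.
intros Hf Hg Hz.
replace ((a * g z - f z * b) / (g z * g z))%C
  with (a * / g z + f z * (- b / (g z * g z)))%C by (field; exact Hz).
apply (cdiff_mult f (fun w => / g w)%C); [exact Hf|apply cdiff_inv; assumption].
Qed.

(** Writing w - z = psi (g w) - psi (g z) = p (g w) (g w - g z) and dividing by p (g w), nonzero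
    near z, exhibits the slope 1 / p (g w). Continuity of g is thus enough; this is how [Clog] is
    differentiated. *)
Lemma cdiff_right_inverse (psi g : C -> C) (z a : C) (d : R) :
  0 < d -> (forall w, Cmod (w - z) < d -> psi (g w) = w) ->
  ccont g z -> cdiff psi (g z) a -> a <> 0%C -> cdiff g z (/ a)%C.
Proof.
intros Hd He Cg [p [P1 [P2 P3]]] Ha.
assert (Cp : ccont (fun w => p (g w)) z) by (apply ccont_comp; assumption).
destruct (ccont_neq_0 _ z Cp) as [d' [Hd' H]]; [rewrite P2; exact Ha|].
rewrite <- P2. apply (cdiff_of_loc g (fun w => / p (g w))%C z (Rmin d d')).
- apply Rmin_pos; assumption.
- apply (ccont_inv (fun w => p (g w))); [exact Cp|rewrite P2; exact Ha].
- intros w Hw.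
  specialize (H w (Rlt_le_trans _ _ _ Hw (Rmin_r _ _))).
  assert (E := P3 (g w)). rewrite He in E by (eapply Rlt_le_trans; [exact Hw|apply Rmin_l]).
  rewrite He in E by (rewrite Cmod_self; exact Hd).
  rewrite (Cminus_eq_of_plus _ _ _ E). field. exact H.
Qed.

Lemma cdiff_of_bound (f : C -> C) (z l : C) :
  (forall eps, 0 < eps -> exists d, 0 < d /\ forall h, Cmod h < d ->
     Cmod (f (z + h)%C - f z - l * h) <= eps * Cmod h) ->
  cdiff f z l.
Proof.
intros H.
exists (fun w => if Ceq_dec w z then l else ((f w - f z) / (w - z))%C).
split; [|split].
- intros e He. destruct (H (e/2)) as [d [Hd H1]]; [lra|].
  exists d. split; [exact Hd|]. intros w Hw.
  destruct (Ceq_dec z z) as [_|n]; [|congruence].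
  destruct (Ceq_dec w z) as [->|n].
  + rewrite Cmod_self. exact He.
  + specialize (H1 _ Hw). replace (z + (w - z))%C with w in H1 by ring.
    assert (N : (w - z)%C <> 0%C).
    { intros E. apply n. replace w with (w - z + z)%C by ring. rewrite E. ring. }
    replace ((f w - f z) / (w - z) - l)%C
      with ((f w - f z - l * (w - z)) / (w - z))%C by (field; exact N).
    rewrite Cmod_div by exact N. apply Cmod_gt_0 in N.
    apply Rle_lt_trans with (e/2); [|lra].
    apply Rmult_le_reg_r with (Cmod (w - z)); [exact N|].
    unfold Rdiv at 1. rewrite Rmult_assoc, Rinv_l, Rmult_1_r by lra. exact H1.
- destruct (Ceq_dec z z); congruence.
- intros w. destruct (Ceq_dec w z) as [->|n]; [ring|].
  field. intros E. apply n. replace w with (w - z + z)%C by ring. rewrite E. ring.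
Qed.

Lemma cdiff_bound (f : C -> C) (z l : C) : cdiff f z l ->
  forall eps, 0 < eps -> exists d, 0 < d /\ forall h, Cmod h < d ->
     Cmod (f (z + h)%C - f z - l * h) <= eps * Cmod h.
Proof.
intros [p [P1 [P2 P3]]] e He. destruct (P1 e He) as [d [Hd H]].
exists d. split; [exact Hd|]. intros h Hh.
specialize (H (z + h)%C). replace (z + h - z)%C with h in H by ring. specialize (H Hh).
rewrite (P3 (z + h)%C), <- P2.
replace (f z + p (z + h) * (z + h - z) - f z - p z * h)%C with ((p (z + h) - p z) * h)%C by ring.
rewrite Cmod_mult. apply Rmult_le_compat_r; [apply Cmod_ge_0|lra].
Qed.

Lemma cdiff_is_derive (f : C -> C) (z l : C) : cdiff f z l <-> is_derive f z l.
Proof.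
split.
- intros Hf. split; [apply is_linear_scal_l|].
  intros x Hx.
  apply (@is_filter_lim_locally_unique C_AbsRing (AbsRing_NormedModule C_AbsRing)) in Hx.
  subst x.
  intros eps. destruct (cdiff_bound _ _ _ Hf eps (cond_pos eps)) as [d [Hd H]].
  exists (mkposreal d Hd). intros y Hy.
  assert (E : forall u v m : C, (z + (u - z))%C = u /\ (m * (u - v))%C = ((u - v) * m)%C)
    by (intros; split; ring).
  specialize (H (y - z)%C Hy).
  rewrite (proj1 (E y z l)), (proj2 (E y z l)) in H. exact H.
- intros [_ Hf]. apply cdiff_of_bound. intros e He.
  destruct (Hf z (fun P HP => HP) (mkposreal e He)) as [d H].
  exists d. split; [apply cond_pos|]. intros h Hh.
  specialize (H (z + h)%C).
  assert (E : (z + h - z)%C = h) by ring.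
  assert (B : @ball (AbsRing_UniformSpace C_AbsRing) z d (z + h)%C).
  { change (Cmod (minus (z + h) z)%C < d). change (minus (z + h)%C z = h) in E.
    rewrite E. exact Hh. }
  specialize (H B). simpl in H.
  change (Cmod (f (z + h)%C - f z - (z + h - z) * l) <= e * Cmod (z + h - z)) in H.
  rewrite E in H.
  replace (l * h)%C with (h * l)%C by ring. exact H.
Qed.

Lemma cdiff_C_derive (f : C -> C) (z l : C) : cdiff f z l -> C_derive f z = l.
Proof. intros H. apply is_C_derive_unique, cdiff_is_derive, H. Qed.

Lemma ex_derive_cdiff (f : C -> C) (z : C) : ex_derive f z -> cdiff f z (C_derive f z).
Proof. intros H. apply cdiff_is_derive, C_derive_correct; assumption. Qed.

Lemma cdiff_ex_derive (f : C -> C) (z l : C) : cdiff f z l -> ex_derive f z.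
Proof. intros H. exists l. apply cdiff_is_derive, H. Qed.

Lemma cdiff_val (f : C -> C) (z l l' : C) : cdiff f z l -> l = l' -> cdiff f z l'.
Proof. intros H <-. exact H. Qed.

(** The mean value theorem holds only for real functions, so every global argument below restricts a
    holomorphic function to a segment a + t b and takes real or imaginary parts. *)
Lemma is_derive_Re_line (f : C -> C) (a b l : C) (t : R) :
  cdiff f (a + RtoC t * b)%C l ->
  is_derive (fun u : R => Re (f (a + RtoC u * b)%C)) t (Re (l * b)%C).
Proof.
intros Hf. split; [apply is_linear_scal_l|].
intros x Hx.
apply (@is_filter_lim_locally_unique R_AbsRing (AbsRing_NormedModule R_AbsRing)) in Hx.
subst x.
intros eps. assert (Hb := Cmod_ge_0 b).
(* Dividing by |b| + 1 instead of |b| covers b = 0. *)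
assert (He : 0 < eps / (Cmod b + 1)) by (apply Rdiv_lt_0_compat; [apply cond_pos|lra]).
destruct (cdiff_bound _ _ _ Hf _ He) as [d [Hd H]].
assert (Hd' : 0 < d / (Cmod b + 1)) by (apply Rdiv_lt_0_compat; lra).
exists (mkposreal _ Hd'). intros y Hy.
change (Rabs (y - t) < d / (Cmod b + 1)) in Hy.
assert (Hm : Cmod (RtoC (y - t) * b) <= Rabs (y - t) * (Cmod b + 1)).
{ rewrite Cmod_mult, Cmod_R. apply Rmult_le_compat_l; [apply Rabs_pos|lra]. }
assert (Hlt : Cmod (RtoC (y - t) * b) < d).
{ eapply Rle_lt_trans; [exact Hm|]. apply Rmult_lt_reg_r with (/ (Cmod b + 1)).
  - apply Rinv_0_lt_compat; lra.
  - rewrite Rmult_assoc, Rinv_r by lra. rewrite Rmult_1_r. exact Hy. }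
specialize (H _ Hlt).
replace (a + RtoC t * b + RtoC (y - t) * b)%C with (a + RtoC y * b)%C in H
  by (rewrite RtoC_minus; ring).
change (Rabs (Re (f (a + RtoC y * b)%C) - Re (f (a + RtoC t * b)%C) - (y - t) * Re (l * b)%C)
  <= eps * Rabs (y - t)).
replace (Re (f (a + RtoC y * b)%C) - Re (f (a + RtoC t * b)%C) - (y - t) * Re (l * b)%C)
  with (Re (f (a + RtoC y * b) - f (a + RtoC t * b) - l * (RtoC (y - t) * b))%C)
  by (unfold Re; simpl; ring).
eapply Rle_trans; [apply re_le_Cmod|]. eapply Rle_trans; [exact H|].
eapply Rle_trans; [apply Rmult_le_compat_l; [lra|exact Hm]|].
right. field. lra.
Qed.

Lemma is_derive_Im_line (f : C -> C) (a b l : C) (t : R) :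
  cdiff f (a + RtoC t * b)%C l ->
  is_derive (fun u : R => Im (f (a + RtoC u * b)%C)) t (Im (l * b)%C).
Proof.
intros Hf.
(* Im v = Re (-i v) reduces this to the previous lemma. *)
assert (H := cdiff_mult (fun _ => - Ci)%C f _ _ _ (cdiff_const _ _) Hf).
apply is_derive_Re_line in H.
replace (Im (l * b)%C) with
  (Re ((0 * f (a + RtoC t * b) + - Ci * l) * b)%C) by (unfold Re, Im; simpl; ring).
apply is_derive_ext with (2 := H). intros u. unfold Re, Im; simpl; ring.
Qed.

(** Serves as the uniqueness principle for identifying power series with closed forms. The mean
    value theorem is applied to both coordinates separately on the segment from 0 to z. *)
Lemma cdiff_zero_const (g : C -> C) :
  (forall z, Cmod z < 1 -> cdiff g z 0%C) -> forall z, Cmod z < 1 -> g z = g 0%C.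
Proof.
intros H z Hz.
assert (D : forall t, 0 <= t <= 1 -> cdiff g (0 + RtoC t * z)%C 0%C).
{ intros t Ht. apply H. rewrite Cplus_0_l, Cmod_mult, Cmod_R, Rabs_pos_eq by lra.
  assert (Z := Cmod_ge_0 z). nra. }
assert (K : forall F : R -> R, (forall t, 0 <= t <= 1 -> is_derive F t 0) -> F 1 = F 0).
{ intros F HF. destruct (MVT_gen F 0 1 (fun _ => 0)) as [c [_ Hc]].
  - intros x. rewrite Rmin_left, Rmax_right by lra. intros Hx. apply HF. lra.
  - intros x. rewrite Rmin_left, Rmax_right by lra. intros Hx.
    apply derivable_continuous_pt. exists 0. apply is_derive_Reals, HF. lra.
  - lra. }
assert (E1 : (0 + RtoC 1 * z)%C = z) by ring.
assert (E0 : (0 + RtoC 0 * z)%C = 0%C) by ring.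
apply injective_projections.
- assert (X := K (fun u => Re (g (0 + RtoC u * z)%C))). cbv beta in X.
  rewrite E1, E0 in X. apply X. intros t Ht.
  assert (E := is_derive_Re_line g 0 z 0 t (D t Ht)).
  replace (Re (0 * z)%C) with 0 in E by (unfold Re; simpl; ring). exact E.
- assert (X := K (fun u => Im (g (0 + RtoC u * z)%C))). cbv beta in X.
  rewrite E1, E0 in X. apply X. intros t Ht.
  assert (E := is_derive_Im_line g 0 z 0 t (D t Ht)).
  replace (Im (0 * z)%C) with 0 in E by (unfold Im; simpl; ring). exact E.
Qed.

(** * Real inequalities *)

Lemma derive_nonneg_le (F F' : R -> R) (u v : R) :
  u <= v ->
  (forall x, u <= x <= v -> is_derive F x (F' x)) ->
  (forall x, u <= x <= v -> 0 <= F' x) -> F u <= F v.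
Proof.
intros Huv HF HF'.
destruct (MVT_gen F u v F') as [c [Hc E]].
- intros x. rewrite Rmin_left, Rmax_right by lra. intros Hx. apply HF. lra.
- intros x. rewrite Rmin_left, Rmax_right by lra. intros Hx.
  apply derivable_continuous_pt. exists (F' x). apply is_derive_Reals, HF, Hx.
- rewrite Rmin_left, Rmax_right in Hc by lra. specialize (HF' c Hc). nra.
Qed.

(** A negative value at x would force a negative slope somewhere before x and a positive one after
    it, although F' is nonincreasing. *)
Lemma concave_nonneg (F F' F'' : R -> R) (u v : R) :
  (forall x, u <= x <= v -> is_derive F x (F' x)) ->
  (forall x, u <= x <= v -> is_derive F' x (F'' x)) ->
  (forall x, u <= x <= v -> F'' x <= 0) ->
  0 <= F u -> 0 <= F v -> forall x, u <= x <= v -> 0 <= F x.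
Proof.
intros H1 H2 H3 Hu Hv x Hx.
destruct (Rle_lt_dec 0 (F x)) as [L|L]; [exact L|exfalso].
destruct (MVT_gen F u x F') as [c [Hc E]].
{ intros y. rewrite Rmin_left, Rmax_right by lra. intros Hy. apply H1. lra. }
{ intros y. rewrite Rmin_left, Rmax_right by lra. intros Hy.
  apply derivable_continuous_pt. exists (F' y). apply is_derive_Reals, H1. lra. }
destruct (MVT_gen F x v F') as [d [Hd E']].
{ intros y. rewrite Rmin_left, Rmax_right by lra. intros Hy. apply H1. lra. }
{ intros y. rewrite Rmin_left, Rmax_right by lra. intros Hy.
  apply derivable_continuous_pt. exists (F' y). apply is_derive_Reals, H1. lra. }
rewrite Rmin_left, Rmax_right in Hc, Hd by lra.
assert (K : - F' c <= - F' d).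
{ apply (derive_nonneg_le (fun y => - F' y) (fun y => - F'' y)); [lra| |].
  - intros y Hy. apply (is_derive_opp F'), H2. lra.
  - intros y Hy. assert (Z := H3 y). lra. }
assert (F' c < 0) by nra. assert (F' d > 0) by nra. lra.
Qed.

(** * Polynomial bounds for the hyperbolic sine *)

Lemma sinh_opp (x : R) : sinh (- x) = - sinh x.
Proof. unfold sinh. rewrite Ropp_involutive. field. Qed.

Lemma cosh_ge_sinh (x : R) : 0 <= x -> 0 <= sinh x <= cosh x.
Proof.
intros Hx. assert (E := exp_pos (- x)). unfold sinh, cosh.
assert (exp (- x) <= exp x).
{ destruct (Req_dec x 0) as [->|N]; [rewrite Ropp_0; lra|]. left. apply exp_increasing. lra. }
lra.
Qed.

Lemma cosh2_sinh2 (x : R) : cosh x * cosh x = 1 + sinh x * sinh x.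
Proof.
unfold cosh, sinh. assert (E : exp x * exp (- x) = 1) by (rewrite <- exp_plus, Rplus_opp_r; apply exp_0).
nra.
Qed.

Lemma cosh_ge_1 (x : R) : 1 <= cosh x.
Proof.
assert (H := cosh2_sinh2 x). assert (0 < cosh x).
{ unfold cosh. assert (E := exp_pos x). assert (E' := exp_pos (-x)). lra. }
nra.
Qed.

Lemma sinh_ge_id (x : R) : 0 <= x -> x <= sinh x.
Proof.
intros Hx. assert (H : sinh 0 - 0 <= sinh x - x).
{ apply (derive_nonneg_le (fun y => sinh y - y) (fun y => cosh y - 1)); [exact Hx| |].
  - intros y _. auto_derive; [exact I|ring].
  - intros y _. assert (C := cosh_ge_1 y). lra. }
rewrite sinh_0 in H. lra.
Qed.

Lemma sinh2_ge (x : R) : x * x <= sinh x * sinh x.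
Proof.
destruct (Rle_lt_dec 0 x) as [H|H].
- assert (K := sinh_ge_id x H). nra.
- assert (K := sinh_ge_id (- x)). rewrite sinh_opp in K. nra.
Qed.

Lemma cosh_at_0 : cosh 0 = 1.
Proof. unfold cosh. rewrite Ropp_0, exp_0. lra. Qed.

(** The concave function 9/4 x - sinh x is nonnegative at 0 and 2; integrating the resulting chord
    bound four times from 0 yields the Taylor terms and the final coefficient (9/4) / (2 * 3 * 4 *
    5) = 3/160. *)
Lemma sinh_le_quintic : forall x : R, 0 <= x <= 2 -> sinh x <= x + x ^ 3 / 6 + 3 / 160 * x ^ 5.
Proof.
assert (K0 : forall x, 0 <= x <= 2 -> 0 <= 9 / 4 * x - sinh x).
{ apply (concave_nonneg _ (fun x => 9 / 4 - cosh x) (fun x => - sinh x)).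
  - intros x _. auto_derive; [exact I|ring].
  - intros x _. auto_derive; [exact I|ring].
  - intros x Hx. assert (C := cosh_ge_sinh x). lra.
  - rewrite sinh_0. lra.
  (* sinh 2 < e^2 / 2 <= 9/2, from e <= 3. *)
  - unfold sinh. assert (E := exp_pos (Ropp 2)). assert (E2 : exp 2 = exp 1 * exp 1)
      by (rewrite <- exp_plus; f_equal; lra).
    assert (E3 := exp_le_3). assert (E4 := exp_pos 1).
    assert (exp 1 * exp 1 <= 3 * 3) by (apply Rmult_le_compat; lra). lra. }
assert (K : forall F F' : R -> R, F 0 = 0 -> (forall x, is_derive F x (F' x)) ->
  (forall x, 0 <= x <= 2 -> 0 <= F' x) -> forall x, 0 <= x <= 2 -> 0 <= F x).
{ intros F F' F0 D P y Hy. rewrite <- F0. apply (derive_nonneg_le F F'); [lra| |].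
  - intros z _. apply D.
  - intros z Hz. apply P. lra. }
assert (K1 : forall x, 0 <= x <= 2 -> 0 <= 1 + 9 / 8 * x ^ 2 - cosh x).
{ apply K with (F' := fun x => 9 / 4 * x - sinh x); [rewrite cosh_at_0; simpl; lra| |exact K0].
  intros x. auto_derive; [exact I|]. simpl; field. }
assert (K2 : forall x, 0 <= x <= 2 -> 0 <= x + 3 / 8 * x ^ 3 - sinh x).
{ apply K with (F' := fun x => 1 + 9 / 8 * x ^ 2 - cosh x); [rewrite sinh_0; simpl; lra| |exact K1].
  intros x. auto_derive; [exact I|]. simpl; field. }
assert (K3 : forall x, 0 <= x <= 2 -> 0 <= 1 + x ^ 2 / 2 + 3 / 32 * x ^ 4 - cosh x).
{ apply K with (F' := fun x => x + 3 / 8 * x ^ 3 - sinh x); [rewrite cosh_at_0; simpl; lra| |exact K2].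
  intros x. auto_derive; [exact I|]. simpl; field. }
intros x Hx.
assert (K4 : 0 <= x + x ^ 3 / 6 + 3 / 160 * x ^ 5 - sinh x).
{ apply (K (fun x => x + x ^ 3 / 6 + 3 / 160 * x ^ 5 - sinh x)
    (fun x => 1 + x ^ 2 / 2 + 3 / 32 * x ^ 4 - cosh x)); [rewrite sinh_0; simpl; lra| |exact K3|exact Hx].
  intros y. auto_derive; [exact I|]. simpl; field. }
lra.
Qed.

(** With x^5 <= 4 x^3 the coefficient is 1/6 + 4 * 3/160 < 1/4. *)
Lemma sinh_le_cubic_2 (x : R) : 0 <= x <= 2 -> sinh x <= x * (1 + x * x / 4).
Proof.
intros Hx. assert (H := sinh_le_quintic x Hx). simpl in H.
assert (0 <= x * x * x) by (apply Rmult_le_pos; nra). assert (x * x <= 4) by nra.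
assert (x * x * x * (x * x) <= x * x * x * 4) by (apply Rmult_le_compat_l; assumption).
lra.
Qed.

(** With x^5 <= x^3 the coefficient is 1/6 + 3/160 < 19/100. *)
Lemma sinh_le_cubic_1 (x : R) : 0 <= x <= 1 -> sinh x <= x * (1 + 19 / 100 * (x * x)).
Proof.
intros Hx. assert (H := sinh_le_quintic x). simpl in H.
assert (0 <= x * x * x) by (apply Rmult_le_pos; nra). assert (x * x <= 1) by nra.
assert (x * x * x * (x * x) <= x * x * x * 1) by (apply Rmult_le_compat_l; assumption).
lra.
Qed.

(** Otherwise cos (8/5) >= 0, while the upper Taylor bound 1 - x^2/2 + x^4/24 is negative at 8/5. *)
Lemma PI2_lt : PI / 2 < 8 / 5.
Proof.
destruct (Rlt_le_dec (PI / 2) (8 / 5)) as [H|H]; [exact H|exfalso].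
assert (C : 0 <= cos (8 / 5)) by (apply cos_ge_0; lra).
destruct (cos_bound (8/5) 0) as [_ B]; [lra|lra|].
unfold cos_approx, cos_term in B. simpl in B. lra.
Qed.

(** sin b - (2/PI) b is concave on the interval and vanishes at both ends. *)
Lemma jordan (b : R) : 0 <= b <= PI / 2 -> 2 / PI * b <= sin b.
Proof.
intros Hb. assert (P := PI_RGT_0).
assert (H : 0 <= sin b - 2 / PI * b); [|lra].
apply (concave_nonneg (fun b => sin b - 2 / PI * b) (fun b => cos b - 2 / PI)
  (fun b => - sin b) 0 (PI / 2)); [| | | | |exact Hb].
- intros x _. auto_derive; [exact I|field; lra].
- intros x _. auto_derive; [exact I|ring].
- intros x Hx. assert (0 <= sin x) by (apply sin_ge_0; lra). lra.
- rewrite sin_0. lra.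
- rewrite sin_PI2. right. field. lra.
Qed.

Lemma jordan_abs (b : R) : Rabs b <= PI / 2 -> Rabs b <= PI / 2 * Rabs (sin b).
Proof.
intros Hb. assert (P := PI_RGT_0).
assert (K : forall x, 0 <= x <= PI / 2 -> x <= PI / 2 * sin x).
{ intros x Hx. assert (J := jordan x Hx).
  apply Rmult_le_compat_l with (r := PI / 2) in J; [|lra].
  replace (PI / 2 * (2 / PI * x)) with x in J by (field; lra). exact J. }
destruct (Rle_lt_dec 0 b) as [H|H].
- rewrite (Rabs_pos_eq b) in * by exact H.
  assert (0 <= sin b) by (apply sin_ge_0; lra).
  rewrite Rabs_pos_eq by assumption. apply K. lra.
- rewrite (Rabs_left b) in * by exact H. rewrite <- (Rabs_Ropp (sin b)), <- sin_neg.
  assert (0 <= sin (- b)) by (apply sin_ge_0; lra).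
  rewrite Rabs_pos_eq by assumption. apply K. lra.
Qed.

(** PI/2 < 8/5 turns the Jordan bound into the factor (5/8)^2 > 39/100. This is the bound for large
    b; [sin2_ge_cubic] is the sharper one for small b. *)
Lemma sin2_ge (b : R) : Rabs b <= PI / 2 -> 39 / 100 * (b * b) <= sin b * sin b.
Proof.
intros Hb. assert (J := jordan_abs b Hb). assert (P := PI2_lt). assert (Q := PI_RGT_0).
assert (A := Rabs_pos b). assert (B := Rabs_pos (sin b)).
assert (Rabs b <= 8 / 5 * Rabs (sin b)) by nra.
assert (Rabs b * Rabs b = b * b) by (rewrite <- Rabs_mult; apply Rabs_pos_eq; nra).
assert (Rabs (sin b) * Rabs (sin b) = sin b * sin b) by (rewrite <- Rabs_mult; apply Rabs_pos_eq; nra).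
nra.
Qed.

Lemma sin_ge_cubic (x : R) : 0 <= x <= PI -> x - x ^ 3 / 6 <= sin x.
Proof.
intros Hx. destruct (sin_bound x 0) as [B _]; [lra|lra|].
unfold sin_approx, sin_term in B. simpl in B. simpl. lra.
Qed.

(** b^2 <= 6 keeps 1 - b^2/6 nonnegative, so that the cubic Taylor bound may be squared. *)
Lemma sin2_ge_cubic (b : R) : Rabs b <= PI / 2 ->
  b * b <= 6 -> b * b * ((1 - b * b / 6) * (1 - b * b / 6)) <= sin b * sin b.
Proof.
intros Hb H6. assert (P := PI_RGT_0).
assert (K : forall x, 0 <= x <= PI / 2 -> x * x <= 6 ->
  x * x * ((1 - x * x / 6) * (1 - x * x / 6)) <= sin x * sin x).
{ intros x Hx H. assert (S := sin_ge_cubic x). simpl in S.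
  assert (0 <= x * (1 - x * x / 6)) by nra.
  assert (x * (1 - x * x / 6) <= sin x) by lra.
  replace (x * x * ((1 - x * x / 6) * (1 - x * x / 6)))
    with (x * (1 - x * x / 6) * (x * (1 - x * x / 6))) by ring.
  apply Rmult_le_compat; assumption. }
destruct (Rle_lt_dec 0 b) as [H|H].
- rewrite Rabs_pos_eq in Hb by exact H. apply K; [lra|exact H6].
- rewrite Rabs_left in Hb by exact H. assert (X := K (- b)). rewrite sin_neg in X.
  replace (- b * - b) with (b * b) in X by ring.
  replace (- sin b * - sin b) with (sin b * sin b) in X by ring. apply X; lra.
Qed.

(** This is the half-plane inequality at the real point s = -A. The difference of the two sides
    vanishes at A = 0 and A = d, and is concave because 2 d - A <= 2 and sinh <= cosh. *)
Lemma sinh_chord (A d : R) : 0 <= A <= d -> d <= 1 -> A * sinh d <= (2 * d - A) * sinh A.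
Proof.
intros HA Hd.
assert (H : 0 <= (2 * d - A) * sinh A - A * sinh d); [|lra].
apply (concave_nonneg (fun A => (2 * d - A) * sinh A - A * sinh d)
  (fun A => - sinh A + (2 * d - A) * cosh A - sinh d)
  (fun A => - 2 * cosh A + (2 * d - A) * sinh A) 0 d); [| | | | |exact HA].
- intros x _. auto_derive; [exact I|ring].
- intros x _. auto_derive; [exact I|ring].
- intros x Hx. assert (C := cosh_ge_sinh x). nra.
- rewrite sinh_0. lra.
- lra.
Qed.

(** With s = a + i b this reads |s|^2 sinh^2 d <= |sinh s|^2 |s + 2 d|^2. The terms free of b are
    compared in [H1], sharp at a = -d, and the terms containing b in [H2], which has numerical
    slack. *)
Lemma half_plane_key (a b d : R) : 0 < d <= 1 -> - d <= a -> Rabs b <= PI / 2 ->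
  (a * a + b * b) * (sinh d * sinh d) <=
  (sinh a * sinh a + sin b * sin b) * ((a + 2 * d) * (a + 2 * d) + b * b).
Proof.
intros Hd Ha Hb.
assert (Hm : d <= sinh d <= 12 / 10 * d).
{ split; [apply sinh_ge_id; lra|]. assert (H := sinh_le_cubic_1 d). nra. }
set (m := sinh d) in *.
assert (HS := sinh2_ge a).
assert (H1 : a * a * (m * m) <= sinh a * sinh a * ((a + 2 * d) * (a + 2 * d))).
{ destruct (Rle_lt_dec 0 a) as [P|P].
  - apply Rmult_le_compat; nra.
  - assert (K := sinh_chord (- a) d). fold m in K. rewrite sinh_opp in K.
    assert (K' : - a * m <= (2 * d - - a) * - sinh a) by (apply K; lra).
    assert (0 <= - a * m) by nra.
    assert (- a * m * (- a * m) <= (2 * d - - a) * - sinh a * ((2 * d - - a) * - sinh a))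
      by (apply Rmult_le_compat; assumption).
    nra. }
set (S := sinh a * sinh a) in *.
(* After division by y = b^2, and with D = (a + 2 d)^2, the claim is m^2 <= sinh^2 a + (sin^2 b /
   b^2) (D + y), where m^2 <= 1.44 d^2 and sinh^2 a >= a^2. *)
assert (H2 : b * b * (m * m) <= b * b * S + sin b * sin b * ((a + 2 * d) * (a + 2 * d))
   + sin b * sin b * (b * b)).
{ assert (S1 := sin2_ge b Hb).
  assert (M2 : m * m <= 144 / 100 * (d * d)) by nra.
  assert (Y := Rle_0_sqr b). unfold Rsqr in Y.
  assert (D0 := Rle_0_sqr (a + 2 * d)). unfold Rsqr in D0.
  set (y := b * b) in *. set (D := (a + 2 * d) * (a + 2 * d)) in *.
  (* Below the threshold sin^2 b / b^2 >= (1 - 0.83/6)^2 > 0.74. Above it only 0.39 is available,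
     but then y contributes at least 0.39 * 0.83 d^2, and 1.12 + 0.39 * 0.83 > 1.44. *)
  destruct (Rle_lt_dec y (83 / 100 * (d * d))) as [Q|Q].
  - assert (y <= 83 / 100) by nra.
    assert (S2 : y * ((1 - y / 6) * (1 - y / 6)) <= sin b * sin b)
      by (apply (sin2_ge_cubic b Hb); fold y; lra).
    assert (S3 : 74 / 100 * y <= sin b * sin b).
    { assert (74 / 100 <= (1 - y / 6) * (1 - y / 6)) by nra. nra. }
    (* The quadratic in a is minimal at a = -(148/174) d, with value 4 * 0.74/1.74 d^2 > 1.44
       d^2. *)
    assert (E : 144 / 100 * (d * d) <= a * a + 74 / 100 * D).
    { unfold D. assert (Z := Rle_0_sqr (a + 148 / 174 * d)). unfold Rsqr in Z. nra. }
    assert (sin b * sin b * D >= 74 / 100 * y * D) by (apply Rle_ge, Rmult_le_compat_r; assumption).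
    assert (y * (144 / 100 * (d * d)) <= y * (a * a + 74 / 100 * D))
      by (apply Rmult_le_compat_l; assumption).
    assert (y * (a * a) <= y * S) by (apply Rmult_le_compat_l; assumption).
    assert (y * (m * m) <= y * (144 / 100 * (d * d))) by (apply Rmult_le_compat_l; assumption).
    assert (0 <= sin b * sin b * y) by nra. lra.
  (* Here the minimum is at a = -(78/139) d, with value 4 * 0.39/1.39 d^2 > 1.12 d^2. *)
  - assert (E : 112 / 100 * (d * d) <= a * a + 39 / 100 * D).
    { unfold D. assert (Z := Rle_0_sqr (139 * a + 78 * d)). unfold Rsqr in Z. nra. }
    assert (sin b * sin b * D >= 39 / 100 * y * D) by (apply Rle_ge, Rmult_le_compat_r; assumption).
    assert (y * (112 / 100 * (d * d)) <= y * (a * a + 39 / 100 * D))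
      by (apply Rmult_le_compat_l; assumption).
    assert (y * (a * a) <= y * S) by (apply Rmult_le_compat_l; assumption).
    assert (y * (m * m) <= y * (144 / 100 * (d * d))) by (apply Rmult_le_compat_l; assumption).
    assert (sin b * sin b * y >= 39 / 100 * y * y) by (apply Rle_ge, Rmult_le_compat_r; assumption).
    assert (y * (83 / 100 * (d * d)) <= y * y) by (apply Rmult_le_compat_l; lra).
    assert (0 <= y * (d * d)) by nra. lra. }
lra.
Qed.

(** Extracts from sinh^2 d - sinh^2 A a factor vanishing to first order at A = d, where the conic
    inequality is sharp. *)
Lemma sinh_diff_squares (x y : R) :
  sinh x * sinh x - sinh y * sinh y = sinh (x - y) * sinh (x + y).
Proof.
unfold sinh.
replace (exp (x - y)) with (exp x * exp (- y)) by (rewrite <- exp_plus; f_equal; ring).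
replace (exp (- (x - y))) with (exp (- x) * exp y) by (rewrite <- exp_plus; f_equal; ring).
replace (exp (- (x + y))) with (exp (- x) * exp (- y)) by (rewrite <- exp_plus; f_equal; ring).
rewrite (exp_plus x y), !exp_Ropp.
assert (P := exp_pos x). assert (Q := exp_pos y).
field. lra.
Qed.

(** Converts the bound on sin^2 b available in [conic_key] into a bound on b^2. The factor (1 +
    d^2/4)(1 + d^2) is what [sinh_le_cubic_2] loses there on sinh (d - A) sinh (d + A). For d near 1
    the factor 1 - d makes the Jordan bound sufficient; for smaller d the hypothesis forces b to be
    small, and the cubic bound applies. *)
Lemma conic_sin_key (b d : R) : 0 < d <= 1 -> Rabs b <= PI / 2 ->
  sin b * sin b <= sinh d * sinh d ->
  (1 - d) * ((1 + d * d / 4) * (1 + d * d)) * (b * b) <= sin b * sin b.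
Proof.
intros Hd Hb HS. assert (P := PI_RGT_0). assert (P2 := PI2_3_2).
assert (Y := Rle_0_sqr b). unfold Rsqr in Y.
destruct (Rle_lt_dec (8 / 10) d) as [H|H].
- assert (S1 := sin2_ge b Hb).
  assert ((1 - d) * ((1 + d * d / 4) * (1 + d * d)) <= 39 / 100).
  (* With e = 1 - d <= 1/5, d^2 = 1 - 2 e + e^2 <= 1 - 1.8 e, and e (2.5 - 2.98 e) stays below 0.39
     on this range. *)
  { assert (E : 0 <= 1 - d <= 2 / 10) by lra. set (e := 1 - d) in *.
    assert (D : d * d <= 1 - 18 / 10 * e) by (replace d with (1 - e) by (unfold e; ring); nra).
    assert (L : (1 + d * d / 4) * (1 + d * d) <=
      (1 + (1 - 18 / 10 * e) / 4) * (1 + (1 - 18 / 10 * e))) by (apply Rmult_le_compat; nra).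
    apply Rle_trans with (e * (25 / 10 - 298 / 100 * e)); [|nra].
    apply Rmult_le_compat_l; [lra|]. eapply Rle_trans; [exact L|]. nra. }
  nra.
(* The coefficient 0.7 is 0.19 + 0.51: u <= 1.448 d gives u^3/6 <= 0.51 d^3, hence u - u^3/6 >= d +
   0.19 d^3 >= sinh d, so that |b| > u would violate the hypothesis. *)
- set (u := d * (1 + 7 / 10 * (d * d))).
  assert (Hd2 : d * d <= 64 / 100) by nra.
  assert (U1 : d <= u <= 1448 / 1000 * d) by (unfold u; split; nra).
  assert (Bu : Rabs b <= u).
  { destruct (Rle_lt_dec (Rabs b) u) as [G|G]; [exact G|exfalso].
    assert (L1 : sin u < sin (Rabs b)) by (apply sin_increasing_1; lra).
    assert (L2 : u - u ^ 3 / 6 <= sin u) by (apply sin_ge_cubic; lra).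
    assert (L3 : sinh d <= u - u ^ 3 / 6).
    { assert (T := sinh_le_cubic_1 d). assert (T' : sinh d <= d * (1 + 19 / 100 * (d * d))) by (apply T; lra).
      assert (u ^ 3 <= 306 / 100 * (d * d * d)).
      { simpl. rewrite Rmult_1_r.
        assert (u * u <= 1448 / 1000 * d * (1448 / 1000 * d)) by (apply Rmult_le_compat; lra).
        assert (u * (u * u) <= 1448 / 1000 * d * (1448 / 1000 * d * (1448 / 1000 * d)))
          by (apply Rmult_le_compat; nra).
        assert (0 <= d * d * d) by (apply Rmult_le_pos; nra). lra. }
      unfold u at 1. lra. }
    assert (L0 : 0 < sinh d) by (assert (Z := sinh_ge_id d); lra).
    assert (L4 : sinh d * sinh d < sin (Rabs b) * sin (Rabs b)) by nra.
    assert (sin (Rabs b) * sin (Rabs b) = sin b * sin b).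
    { unfold Rabs. destruct (Rcase_abs b); [rewrite sin_neg|]; ring. }
    lra. }
  assert (Bb : b * b <= 21 / 10 * (d * d)).
  { replace (b * b) with (Rabs b * Rabs b) by (rewrite <- Rabs_mult; apply Rabs_pos_eq; exact Y).
    assert (Z := Rabs_pos b). assert (Rabs b * Rabs b <= u * u) by (apply Rmult_le_compat; lra). nra. }
  assert (S1 := sin2_ge_cubic b Hb).
  assert (S2 : b * b * ((1 - b * b / 6) * (1 - b * b / 6)) <= sin b * sin b) by (apply S1; lra).
  set (y := b * b) in *.
  (* 0.35 = 2.1/6, where 2.1 > 1.448^2 bounds y / d^2. *)
  assert (E : (1 - 35 / 100 * (d * d)) * (1 - 35 / 100 * (d * d)) <= (1 - y / 6) * (1 - y / 6)).
  { apply Rmult_le_compat; lra. }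
  assert (G : (1 - d) * ((1 + d * d / 4) * (1 + d * d)) <=
    (1 - 35 / 100 * (d * d)) * (1 - 35 / 100 * (d * d))).
  { assert (0 <= d * (1 - d)) by nra. assert (0 <= d * d * d) by (apply Rmult_le_pos; nra). nra. }
  nra.
Qed.

(** For k = (1 - d)/d this is the square of k |s| <= 1 + Re s, with s = a + i b. The worst sign is a
    = -A, where A = |a|. *)
Lemma conic_key (a b d : R) : 0 < d <= 1 -> Rabs b <= PI / 2 ->
  sinh a * sinh a + sin b * sin b <= sinh d * sinh d ->
  (1 - d) * (1 - d) * (a * a + b * b) <= d * d * ((1 + a) * (1 + a)).
Proof.
intros Hd Hb H.
assert (HA : Rabs a <= d).
{ destruct (Rle_lt_dec (Rabs a) d) as [G|G]; [exact G|exfalso].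
  assert (L : sinh d < sinh (Rabs a)) by (apply sinh_lt, G).
  assert (Z := sinh_ge_id d).
  assert (E : sinh (Rabs a) * sinh (Rabs a) = sinh a * sinh a).
  { unfold Rabs. destruct (Rcase_abs a); [rewrite sinh_opp|]; ring. }
  assert (Y := Rle_0_sqr (sin b)). unfold Rsqr in Y. nra. }
assert (A0 := Rabs_pos a).
set (A := Rabs a) in *.
assert (EA : a * a = A * A) by (unfold A; rewrite <- Rabs_mult; symmetry; apply Rabs_pos_eq; nra).
assert (ES : sinh a * sinh a = sinh A * sinh A).
{ unfold A, Rabs. destruct (Rcase_abs a); [rewrite sinh_opp|]; ring. }
assert (Ea : - A <= a) by (unfold A; rewrite <- Rabs_Ropp; assert (T := Rle_abs (- a)); lra).
assert (K := conic_sin_key b d Hd Hb).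
assert (Y := Rle_0_sqr b). unfold Rsqr in Y.
assert (YA := Rle_0_sqr (sinh A)). unfold Rsqr in YA.
assert (K' : (1 - d) * ((1 + d * d / 4) * (1 + d * d)) * (b * b) <= sin b * sin b) by (apply K; lra).
set (L := (1 + d * d / 4) * (1 + d * d)) in *.
assert (HL : 1 <= L) by (unfold L; nra).
assert (F := sinh_diff_squares d A).
assert (F1 : 0 <= sinh (d - A) <= (d - A) * (1 + d * d / 4)).
{ assert (Z := sinh_ge_id (d - A)). assert (Z' := sinh_le_cubic_2 (d - A)).
  split; [lra|]. eapply Rle_trans; [apply Z'; lra|]. apply Rmult_le_compat_l; [lra|]. nra. }
assert (F2 : 0 <= sinh (d + A) <= (d + A) * (1 + d * d)).
{ assert (Z := sinh_ge_id (d + A)). assert (Z' := sinh_le_cubic_2 (d + A)).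
  split; [lra|]. eapply Rle_trans; [apply Z'; lra|]. apply Rmult_le_compat_l; [lra|]. nra. }
assert (F3 : sinh (d - A) * sinh (d + A) <= L * ((d - A) * (d + A))).
{ replace (L * ((d - A) * (d + A))) with ((d - A) * (1 + d * d / 4) * ((d + A) * (1 + d * d)))
    by (unfold L; ring). apply Rmult_le_compat; lra. }
assert (G : (1 - d) * (b * b) <= (d - A) * (d + A)).
{ apply Rmult_le_reg_l with L; [lra|]. lra. }
assert (G2 : (1 - d) * ((1 - d) * (b * b)) <= (1 - d) * ((d - A) * (d + A)))
  by (apply Rmult_le_compat_l; lra).
(* The right side is exactly d^2 (1 - A)^2 - (1 - d)^2 A^2, factored as a difference of squares; it
   remains to use d A <= d^2. *)
assert (G3 : (1 - d) * ((d - A) * (d + A)) <= (d - A) * (d + A - 2 * d * A)).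
{ assert (0 <= d * (d - A)) by (apply Rmult_le_pos; lra).
  replace ((1 - d) * ((d - A) * (d + A))) with ((d - A) * ((1 - d) * (d + A))) by ring.
  apply Rmult_le_compat_l; lra. }
assert (G4 : (1 - A) * (1 - A) <= (1 + a) * (1 + a)) by (apply Rmult_le_compat; lra).
assert (d * d * ((1 - A) * (1 - A)) <= d * d * ((1 + a) * (1 + a)))
  by (apply Rmult_le_compat_l; nra).
rewrite EA. lra.
Qed.

(** * Exponential, logarithm and asinh *)

Lemma Cmod_sqr (z : C) : Cmod z * Cmod z = Re z * Re z + Im z * Im z.
Proof. assert (H := Cmod2_alt z). simpl in H. lra. Qed.

Lemma Cmod_le_sum (z : C) : Cmod z <= Rabs (Re z) + Rabs (Im z).
Proof.
assert (H := Cmod_sqr z). assert (P := Cmod_ge_0 z).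
assert (A := Rabs_pos (Re z)). assert (B := Rabs_pos (Im z)).
assert (Rabs (Re z) * Rabs (Re z) = Re z * Re z) by (rewrite <- Rabs_mult; apply Rabs_pos_eq; nra).
assert (Rabs (Im z) * Rabs (Im z) = Im z * Im z) by (rewrite <- Rabs_mult; apply Rabs_pos_eq; nra).
nra.
Qed.

Lemma Cexp_plus (a b : C) : Cexp (a + b) = (Cexp a * Cexp b)%C.
Proof.
unfold Cexp, Re, Im. simpl. rewrite exp_plus, cos_plus, sin_plus.
apply injective_projections; simpl; ring.
Qed.

Lemma Cexp_0 : Cexp 0 = 1%C.
Proof. unfold Cexp, Re, Im. simpl. rewrite exp_0, cos_0, sin_0. apply injective_projections; simpl; ring. Qed.

Lemma Cmod_Cexp (z : C) : Cmod (Cexp z) = exp (Re z).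
Proof.
assert (H := Cmod_sqr (Cexp z)). assert (P := Cmod_ge_0 (Cexp z)). assert (E := exp_pos (Re z)).
assert (S := sin2_cos2 (Im z)). unfold Rsqr in S.
assert (K : Cmod (Cexp z) * Cmod (Cexp z) = exp (Re z) * exp (Re z)).
{ rewrite H.
  change (exp (Re z) * cos (Im z) * (exp (Re z) * cos (Im z))
    + exp (Re z) * sin (Im z) * (exp (Re z) * sin (Im z)) = exp (Re z) * exp (Re z)).
  transitivity (exp (Re z) * exp (Re z) * (sin (Im z) * sin (Im z) + cos (Im z) * cos (Im z)));
    [ring|]. rewrite S. ring. }
nra.
Qed.

Lemma Cexp_neq_0 (z : C) : Cexp z <> 0%C.
Proof. apply Cmod_gt_0. rewrite Cmod_Cexp. apply exp_pos. Qed.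

Lemma Cexp_opp (z : C) : Cexp (- z) = (/ Cexp z)%C.
Proof.
assert (N := Cexp_neq_0 z).
assert (H : (Cexp z * Cexp (- z))%C = 1%C).
{ rewrite <- Cexp_plus. replace (z + - z)%C with (RtoC 0) by ring. apply Cexp_0. }
replace (Cexp (- z)) with (Cexp z * Cexp (- z) / Cexp z)%C by (field; exact N).
rewrite H. field. exact N.
Qed.

(** The upper bound combines exp x (1 - x) <= exp x exp (-x) = 1 with (1 + x + 2 x^2)(1 - x) = 1 +
    x^2 (1 - 2 x) >= 1. *)
Lemma exp_taylor2 (x : R) : Rabs x <= 1 / 2 -> 0 <= exp x - 1 - x <= 2 * (x * x).
Proof.
intros Hx. apply Rabs_le_between in Hx.
assert (A := exp_ineq1_le x). assert (B := exp_ineq1_le (- x)).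
assert (E : exp x * exp (- x) = 1) by (rewrite <- exp_plus, Rplus_opp_r; apply exp_0).
assert (P := exp_pos x). split; [lra|].
assert (exp x * (1 - x) <= 1) by nra.
assert (1 <= (1 + x + 2 * (x * x)) * (1 - x)) by nra.
nra.
Qed.

Lemma Rabs_sin_le (y : R) : Rabs (sin y) <= Rabs y.
Proof.
assert (K : forall x, 0 <= x -> Rabs (sin x) <= x).
{ intros x Hx. destruct (Rle_lt_dec x 1) as [H|H].
  - assert (P := PI2_3_2). rewrite Rabs_pos_eq by (apply sin_ge_0; lra).
    destruct (Req_dec x 0) as [->|N]; [rewrite sin_0; lra|]. left. apply sin_lt_x. lra.
  - apply Rabs_le. assert (S := SIN_bound x). lra. }
destruct (Rle_lt_dec 0 y) as [H|H].
- rewrite (Rabs_pos_eq y) by exact H. apply K, H.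
- rewrite (Rabs_left y) by exact H. rewrite <- (Rabs_Ropp (sin y)), <- sin_neg. apply K. lra.
Qed.

Lemma Rabs_sqr (x : R) : Rabs x * Rabs x = x * x.
Proof. rewrite <- Rabs_mult. apply Rabs_pos_eq. apply Rle_0_sqr. Qed.

Lemma cos_taylor2 (y : R) : 0 <= 1 - cos y <= y * y / 2.
Proof.
assert (C := COS_bound y). split; [lra|].
replace y with (2 * (y / 2)) at 1 by field. rewrite cos_2a_sin.
assert (H := Rabs_sin_le (y / 2)). assert (P := Rabs_pos (sin (y / 2))).
assert (E := Rabs_sqr (sin (y / 2))). assert (E' := Rabs_sqr (y / 2)).
assert (Rabs (sin (y / 2)) * Rabs (sin (y / 2)) <= Rabs (y / 2) * Rabs (y / 2))
  by (apply Rmult_le_compat; assumption). lra.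
Qed.

Lemma sin_taylor2 (y : R) : Rabs y <= 1 -> Rabs (sin y - y) <= y * y.
Proof.
assert (K : forall x, 0 <= x <= 1 -> Rabs (sin x - x) <= x * x).
{ intros x Hx. assert (P := PI2_3_2). assert (S := sin_ge_cubic x). simpl in S.
  assert (B := Rabs_sin_le x). rewrite (Rabs_pos_eq x) in B by lra.
  assert (L := Rle_abs (sin x)). apply Rabs_le.
  assert (x * x * x <= x * x) by nra. lra. }
intros Hy. destruct (Rle_lt_dec 0 y) as [H|H].
- rewrite Rabs_pos_eq in Hy by exact H. apply K; lra.
- rewrite Rabs_left in Hy by exact H. assert (X := K (- y)). rewrite sin_neg in X.
  rewrite <- Rabs_Ropp. replace (- (sin y - y)) with (- sin y - - y) by ring.
  eapply Rle_trans; [apply X; lra|]. lra.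
Qed.

(** Any quadratic remainder yields the derivative of [Cexp]; the two coordinates contribute at most
    2 x^2 + y^2 and 2 y^2 + 2 |x| |y|. *)
Lemma Cexp_taylor2 (h : C) : Cmod h <= 1 / 2 -> Cmod (Cexp h - 1 - h) <= 6 * (Cmod h * Cmod h).
Proof.
intros Hh. destruct h as [x y]. assert (E := Cmod_sqr (x, y)). unfold Re, Im in E. simpl in E.
assert (Bx : Rabs x <= 1 / 2) by (eapply Rle_trans; [apply (re_le_Cmod (x, y))|exact Hh]).
assert (By : Rabs y <= 1 / 2).
{ assert (Z := Rmax_Cmod (x, y)). assert (Z' := Rmax_r (Rabs x) (Rabs y)). simpl in Z. lra. }
rewrite E. eapply Rle_trans; [apply Cmod_le_sum|].
unfold Cexp, Re, Im. simpl.
assert (T1 := exp_taylor2 x Bx). assert (T2 := cos_taylor2 y).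
assert (T3 := sin_taylor2 y ltac:(lra)).
apply Rabs_le_between in Bx. assert (EX : 0 < exp x <= 2) by (split; [apply exp_pos|nra]).
assert (A1 : Rabs (exp x * cos y + - (1) + - x) <= 2 * (x * x) + y * y).
{ replace (exp x * cos y + - (1) + - x) with ((exp x - 1 - x) - exp x * (1 - cos y)) by ring.
  apply Rabs_le. nra. }
assert (A2 : Rabs (exp x * sin y + - 0 + - y) <= 2 * (y * y) + 2 * Rabs x * Rabs y).
{ replace (exp x * sin y + - 0 + - y) with (exp x * (sin y - y) + (exp x - 1) * y) by ring.
  eapply Rle_trans; [apply Rabs_triang|]. rewrite !Rabs_mult. apply Rplus_le_compat.
  - rewrite (Rabs_pos_eq (exp x)) by lra. apply Rmult_le_compat; try lra. apply Rabs_pos.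
  - apply Rmult_le_compat_r; [apply Rabs_pos|].
    replace (exp x - 1) with ((exp x - 1 - x) + x) by ring.
    eapply Rle_trans; [apply Rabs_triang|]. rewrite (Rabs_pos_eq (exp x - 1 - x)) by lra.
    assert (S := Rabs_sqr x). assert (P := Rabs_pos x).
    assert (Rabs x <= 1 / 2) by (apply Rabs_le; lra). nra. }
assert (S := Rabs_sqr x). assert (S' := Rabs_sqr y).
assert (Q := Rle_0_sqr (Rabs x - Rabs y)). unfold Rsqr in Q.
assert (0 <= x * x) by nra. assert (0 <= y * y) by nra. nra.
Qed.

Lemma cdiff_Cexp (z : C) : cdiff Cexp z (Cexp z).
Proof.
apply cdiff_of_bound. intros e He.
assert (P : 0 < Cmod (Cexp z)) by (rewrite Cmod_Cexp; apply exp_pos).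
assert (D : 0 < e / (6 * Cmod (Cexp z))) by (apply Rdiv_lt_0_compat; lra).
exists (Rmin (1 / 2) (e / (6 * Cmod (Cexp z)))). split; [apply Rmin_pos; lra|].
intros h Hh.
assert (H1 := Rlt_le_trans _ _ _ Hh (Rmin_l _ _)).
assert (H2 := Rlt_le_trans _ _ _ Hh (Rmin_r _ _)).
rewrite Cexp_plus.
replace (Cexp z * Cexp h - Cexp z - Cexp z * h)%C with (Cexp z * (Cexp h - 1 - h))%C by ring.
rewrite Cmod_mult. assert (T := Cexp_taylor2 h ltac:(lra)).
assert (Q := Cmod_ge_0 h).
apply Rle_trans with (Cmod (Cexp z) * (6 * (Cmod h * Cmod h))); [apply Rmult_le_compat_l; lra|].
replace (Cmod (Cexp z) * (6 * (Cmod h * Cmod h))) with ((Cmod h * (6 * Cmod (Cexp z))) * Cmod h) by ring.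
apply Rmult_le_compat_r; [exact Q|].
apply Rle_trans with (e / (6 * Cmod (Cexp z)) * (6 * Cmod (Cexp z))); [apply Rmult_le_compat_r; lra|].
right. field. lra.
Qed.

Lemma Clog_half_plane (z : C) : 0 < Re z -> Rabs (Im (Clog z)) < PI / 2.
Proof.
intros Hz. assert (N : z <> 0%C) by (intros E; rewrite E in Hz; unfold Re in Hz; simpl in Hz; lra).
destruct (Clog_principal z N) as [E B]. assert (P := PI_RGT_0).
assert (C : 0 < cos (Im (Clog z))).
{ rewrite <- E in Hz. change (0 < exp (Re (Clog z)) * cos (Im (Clog z))) in Hz.
  apply Rmult_lt_reg_l with (exp (Re (Clog z))); [apply exp_pos|]. rewrite Rmult_0_r. exact Hz. }
set (b := Im (Clog z)) in *.
apply Rabs_lt_between.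
destruct (Rlt_le_dec b (PI / 2)) as [H1|H1].
- destruct (Rlt_le_dec (- (PI / 2)) b) as [H2|H2]; [lra|exfalso].
  assert (K : cos (- b) <= 0) by (apply cos_le_0; lra). rewrite cos_neg in K. lra.
- exfalso. assert (K : cos b <= 0) by (apply cos_le_0; lra). lra.
Qed.

Lemma continuous_ccont (f : C -> C) (z : C) :
  continuous (fun w : C => Re (f w)) z -> continuous (fun w : C => Im (f w)) z -> ccont f z.
Proof.
intros H1 H2 e He.
assert (He2 : 0 < e / 2) by lra.
assert (L1 := proj1 (filterlim_locally _ _) H1 (mkposreal _ He2)).
assert (L2 := proj1 (filterlim_locally _ _) H2 (mkposreal _ He2)).
destruct (filter_and _ _ L1 L2) as [d H].
exists d. split; [apply cond_pos|]. intros w Hw.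
destruct (H w) as [B1 B2].
- apply (C_NormedModule_mixin_compat1 z w d Hw).
- change (Rabs (Re (f w) - Re (f z)) < e / 2) in B1.
  change (Rabs (Im (f w) - Im (f z)) < e / 2) in B2.
  eapply Rle_lt_trans; [apply Cmod_le_sum|].
  replace (Re (f w - f z)%C) with (Re (f w) - Re (f z)) by (unfold Re; simpl; ring).
  replace (Im (f w - f z)%C) with (Im (f w) - Im (f z)) by (unfold Im; simpl; ring). lra.
Qed.

Lemma continuous_Cmod (z : C) : continuous (fun w : C => Cmod w) z.
Proof. exact (filterlim_norm (V := C_NormedModule) z). Qed.

Lemma Carg_half_plane (z : C) : 0 < Re z -> Carg z = 2 * atan (Im z / (Cmod z + Re z)).
Proof.
intros Hz. unfold Carg. destruct (Req_EM_T _ _); [|reflexivity].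
destruct (Rlt_dec _ _); [lra|reflexivity].
Qed.

(** Within distance Re z of z one stays in the right half-plane, where the argument is given by the
    single half-angle formula with positive denominator. *)
Lemma ccont_Clog (z : C) : 0 < Re z -> ccont Clog z.
Proof.
intros Hz.
assert (M := re_le_Cmod z). rewrite Rabs_pos_eq in M by lra.
apply (ccont_ext_loc (fun w => (ln (Cmod w), 2 * atan (Im w / (Cmod w + Re w)))) _ z (Re z) Hz).
{ intros w Hw. unfold Clog. f_equal. symmetry. apply Carg_half_plane.
  assert (Z := re_le_Cmod (w - z)%C). assert (Z' := Rle_lt_trans _ _ _ Z Hw).
  apply Rabs_lt_between in Z'. unfold Re in *. simpl in Z'. lra. }
apply continuous_ccont; unfold Re at 1, Im at 1; simpl.
- apply (continuous_comp Cmod ln); [apply continuous_Cmod|].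
  apply continuity_pt_filterlim. apply derivable_continuous_pt.
  exists (/ Cmod z). apply derivable_pt_lim_ln. lra.
- apply (continuous_scal_r 2 (fun w : C => atan (Im w / (Cmod w + Re w)))).
  apply (continuous_comp (fun w : C => Im w / (Cmod w + Re w)) atan).
  + apply (continuous_mult (fun w : C => Im w) (fun w : C => / (Cmod w + Re w))).
    * apply continuous_snd.
    * apply (continuous_comp (fun w : C => Cmod w + Re w) Rinv).
      -- apply (continuous_plus (fun w : C => Cmod w) (fun w : C => Re w)).
         ++ apply continuous_Cmod.
         ++ apply continuous_fst.
      -- apply continuous_Rinv. unfold Re in *. lra.
  + apply continuity_pt_filterlim. apply derivable_continuous_pt, derivable_pt_atan.
Qed.

Lemma cdiff_Clog (z : C) : 0 < Re z -> cdiff Clog z (/ z)%C.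
Proof.
intros Hz. assert (N : z <> 0%C) by (intros E; rewrite E in Hz; unfold Re in Hz; simpl in Hz; lra).
assert (P : 0 < Cmod z) by (apply Cmod_gt_0, N).
apply (cdiff_right_inverse Cexp Clog z z (Cmod z) P).
- intros w Hw. apply Clog_principal. intros E. rewrite E in Hw.
  replace (0 - z)%C with (- z)%C in Hw by ring. rewrite Cmod_opp in Hw. lra.
- apply ccont_Clog, Hz.
- assert (D := cdiff_Cexp (Clog z)). rewrite (proj1 (Clog_principal z N)) in D. exact D.
- exact N.
Qed.

Lemma Re_pos_neq_0 (z : C) : 0 < Re z -> z <> 0%C.
Proof. intros Hz E. rewrite E in Hz. unfold Re in Hz. simpl in Hz. lra. Qed.

Lemma Re_1_plus_sqr (z : C) : Cmod z < 1 -> 0 < Re (1 + z * z)%C.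
Proof.
intros Hz. assert (P := Cmod_ge_0 z). assert (M := re_le_Cmod (z * z)%C).
rewrite Cmod_mult in M. assert (Rabs (Re (z * z)%C) < 1) by nra.
apply Rabs_lt_between in H.
change (-1 < Re (z * z)%C < 1) in H. change (0 < 1 + Re (z * z)%C). lra.
Qed.

(** * The square root of 1 + z^2 and asinh on the disc *)

Definition cosh_asinh (z : C) : C := Csqrt (1 + z * z).

Lemma Csqrt_half_plane (w : C) : 0 < Re w ->
  Csqrt w = Cexp (Clog w / 2) /\ (Csqrt w * Csqrt w)%C = w /\ 0 < Re (Csqrt w).
Proof.
intros Hw. assert (N := Re_pos_neq_0 w Hw).
assert (E : Csqrt w = Cexp (Clog w / 2)).
{ unfold Csqrt. destruct (Ceq_dec w 0); [contradiction|reflexivity]. }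
rewrite E. split; [reflexivity|]. split.
- rewrite <- Cexp_plus. replace (Clog w / 2 + Clog w / 2)%C with (Clog w) by field.
  apply Clog_principal, N.
- assert (B := Clog_half_plane w Hw). apply Rabs_lt_between in B. assert (P := PI_RGT_0).
  change (0 < exp (Re (Clog w / 2)%C) * cos (Im (Clog w / 2)%C)).
  apply Rmult_lt_0_compat; [apply exp_pos|].
  assert (H : Im (Clog w / 2)%C = Im (Clog w) / 2).
  { destruct (Clog w) as [p q]. unfold Im. simpl. field. }
  rewrite H. apply cos_gt_0; lra.
Qed.

Lemma cosh_asinh_sqr (z : C) : Cmod z < 1 ->
  (cosh_asinh z * cosh_asinh z)%C = (1 + z * z)%C /\ 0 < Re (cosh_asinh z).
Proof. intros Hz. apply Csqrt_half_plane, Re_1_plus_sqr, Hz. Qed.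

Lemma cosh_asinh_neq_0 (z : C) : Cmod z < 1 -> cosh_asinh z <> 0%C.
Proof. intros Hz. apply Re_pos_neq_0, cosh_asinh_sqr, Hz. Qed.

Lemma Cmod_near (z w : C) : Cmod z < 1 -> Cmod (w - z) < 1 - Cmod z -> Cmod w < 1.
Proof.
intros Hz Hw. assert (T := Cmod_triangle (w - z) z).
replace (w - z + z)%C with w in T by ring. lra.
Qed.

Lemma cdiff_cosh_asinh (z : C) : Cmod z < 1 -> cdiff cosh_asinh z (z / cosh_asinh z)%C.
Proof.
intros Hz. assert (D : 0 < 1 - Cmod z) by lra.
apply (cdiff_ext_loc (fun w => Cexp (Clog (1 + w * w) * / 2))%C _ z _ (1 - Cmod z) D).
{ intros w Hw. symmetry. apply Csqrt_half_plane, Re_1_plus_sqr.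
  apply Cmod_near with z; assumption. }
assert (H1 : cdiff (fun w => 1 + w * w)%C z (0 + (1 * z + z * 1))%C).
{ apply (cdiff_plus (fun _ => RtoC 1) (fun w => w * w)%C); [apply cdiff_const|].
  apply (cdiff_mult (fun w => w) (fun w => w)); apply cdiff_id. }
assert (P := Re_1_plus_sqr z Hz).
assert (H2 := cdiff_comp Clog _ z _ _ (cdiff_Clog _ P) H1).
assert (H3 := cdiff_mult _ _ z _ _ H2 (cdiff_const (/ 2)%C z)).
assert (H4 := cdiff_comp Cexp _ z _ _ (cdiff_Cexp _) H3).
eapply cdiff_val; [exact H4|].
destruct (Csqrt_half_plane _ P) as [E1 [E2 _]].
change (Clog (1 + z * z) * / 2)%C with (Clog (1 + z * z) / 2)%C. rewrite <- E1.
fold (cosh_asinh z). fold (cosh_asinh z) in E2. rewrite <- E2.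
field. apply cosh_asinh_neq_0, Hz.
Qed.

(** u = z + T and v = T - z satisfy u v = T^2 - z^2 = 1, so v is conj u / |u|^2 and Re u, Re v have
    the same sign; their sum is 2 Re T > 0. This keeps the argument of [Clog] in [Casinh] off the
    branch cut. *)
Lemma Re_asinh_arg (z : C) : Cmod z < 1 -> 0 < Re (z + cosh_asinh z)%C.
Proof.
intros Hz. destruct (cosh_asinh_sqr z Hz) as [E P]. set (T := cosh_asinh z) in *.
set (u := (z + T)%C). set (v := (T - z)%C).
assert (UV : (u * v)%C = 1%C).
{ unfold u, v. replace ((z + T) * (T - z))%C with (T * T - z * z)%C by ring. rewrite E. ring. }
assert (S : 0 < Re u + Re v).
{ change (0 < (Re z + Re T) + (Re T + - Re z)). lra. }
assert (U := Cmod_sqr u).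
assert (X : Re v * (Cmod u * Cmod u) = Re u).
{ rewrite U. destruct u as [a b], v as [c d]. unfold Re, Im in *. simpl in *.
  injection UV as U1 U2.
  replace (c * (a * a + b * b)) with (a * (a * c - b * d) + b * (a * d + b * c)) by ring.
  rewrite U1, U2. ring. }
assert (Q := Cmod_ge_0 u). fold u.
destruct (Rlt_le_dec 0 (Re u)) as [L|L]; [exact L|exfalso].
assert (0 < Re v) by lra. assert (0 <= Re v * (Cmod u * Cmod u)) by nra.
assert (Re u = 0) by lra. assert (Re v * (Cmod u * Cmod u) = 0) by lra.
apply Rmult_integral in H2. destruct H2 as [H2|H2]; [lra|].
assert (Z : Cmod u = 0) by nra. apply Cmod_eq_0 in Z. rewrite Z, Cmult_0_l in UV.
injection UV. lra.
Qed.

Lemma Cexp_Casinh (z : C) : Cmod z < 1 -> Cexp (Casinh z) = (z + cosh_asinh z)%C.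
Proof. intros Hz. apply Clog_principal, Re_pos_neq_0, Re_asinh_arg, Hz. Qed.

Lemma cdiff_Casinh (z : C) : Cmod z < 1 -> cdiff Casinh z (/ cosh_asinh z)%C.
Proof.
intros Hz. assert (P := Re_asinh_arg z Hz). assert (N := cosh_asinh_neq_0 z Hz).
assert (H := cdiff_plus (fun w => w) _ z _ _ (cdiff_id z) (cdiff_cosh_asinh z Hz)).
assert (H2 := cdiff_comp Clog _ z _ _ (cdiff_Clog _ P) H).
eapply cdiff_val; [exact H2|].
assert (N' := Re_pos_neq_0 _ P). field. split; assumption.
Qed.

(** With s = [Casinh z], e^s = z + T and e^(-s) = T - z, whose half difference is z = sinh s, here
    split into coordinates. *)
Lemma Casinh_spec (z : C) : Cmod z < 1 ->
  Rabs (Im (Casinh z)) < PI / 2 /\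
  Re z = sinh (Re (Casinh z)) * cos (Im (Casinh z)) /\
  Im z = cosh (Re (Casinh z)) * sin (Im (Casinh z)).
Proof.
intros Hz. split; [apply Clog_half_plane, Re_asinh_arg, Hz|].
assert (E := Cexp_Casinh z Hz). destruct (cosh_asinh_sqr z Hz) as [S P].
assert (N := Re_pos_neq_0 _ (Re_asinh_arg z Hz)).
assert (E' := Cexp_opp (Casinh z)). rewrite E in E'.
set (s := Casinh z) in *. set (T := cosh_asinh z) in *.
assert (I : (/ (z + T))%C = (T - z)%C).
{ replace (T - z)%C with ((T * T - z * z) / (z + T))%C by (field; exact N).
  rewrite S. field. exact N. }
rewrite I in E'. unfold Cexp in E, E'.
destruct s as [a b], z as [x y], T as [p q]. unfold Re, Im in *. simpl in *.
injection E as E1 E2. injection E' as F1 F2.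
rewrite cos_neg in F1. rewrite sin_neg in F2. unfold sinh, cosh. split; lra.
Qed.

Lemma Casinh_mod (z : C) : Cmod z < 1 ->
  sinh (Re (Casinh z)) * sinh (Re (Casinh z)) + sin (Im (Casinh z)) * sin (Im (Casinh z))
  = Cmod z * Cmod z.
Proof.
intros Hz. destruct (Casinh_spec z Hz) as [_ [E1 E2]]. rewrite Cmod_sqr, E1, E2.
assert (C := cosh2_sinh2 (Re (Casinh z))). assert (S := sin2_cos2 (Im (Casinh z))).
unfold Rsqr in S. set (a := Re (Casinh z)) in *. set (b := Im (Casinh z)) in *.
replace (sinh a * cos b * (sinh a * cos b) + cosh a * sin b * (cosh a * sin b))
  with (sinh a * sinh a * (cos b * cos b) + (cosh a * cosh a) * (sin b * sin b)) by ring.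
rewrite C. replace (cos b * cos b) with (1 - sin b * sin b) by lra. ring.
Qed.

(** Im z = 0 gives cosh a sin b = 0, and |b| < PI/2 then leaves only b = 0. *)
Lemma Casinh_real (x : R) : Rabs x < 1 -> Casinh (RtoC x) = RtoC (arcsinh x).
Proof.
intros Hx. assert (Hz : Cmod (RtoC x) < 1) by (rewrite Cmod_R; exact Hx).
destruct (Casinh_spec _ Hz) as [B [E1 E2]].
set (a := Re (Casinh x)) in *. set (b := Im (Casinh x)) in *.
unfold Re, Im in E1, E2. simpl in E1, E2.
assert (C := cosh_ge_1 a).
assert (S : sin b = 0) by nra.
assert (B0 : b = 0).
{ assert (J := jordan_abs b ltac:(lra)). rewrite S, Rabs_R0 in J.
  assert (Q := Rabs_pos b). destruct (Req_dec b 0) as [|N]; [assumption|].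
  apply Rabs_no_R0 in N. lra. }
rewrite B0, cos_0, Rmult_1_r in E1.
assert (A : a = arcsinh x) by (rewrite E1; symmetry; apply arcsinh_sinh).
apply injective_projections; [exact A|exact B0].
Qed.

Lemma Casinh_0 : Casinh 0 = 0%C.
Proof. rewrite Casinh_real, arcsinh_0; [reflexivity|]. rewrite Rabs_R0. lra. Qed.

(** * Power series on the unit disc *)

Lemma is_series_C_ext (u v : nat -> C) (l : C) :
  (forall n, u n = v n) -> is_series u l -> is_series v l.
Proof. exact (is_series_ext u v l). Qed.

Lemma is_series_Cmod_le (u : nat -> C) (l : C) (v : nat -> R) (L : R) :
  is_series u l -> is_series v L -> (forall n, Cmod (u n) <= v n) -> Cmod l <= L.
Proof.
intros Hu Hv H.
assert (K := filterlim_comp _ _ _ _ _ _ _ _ Hu (filterlim_norm (V := C_NormedModule) l)).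
apply (is_lim_seq_le (fun n => Cmod (sum_n u n)) (sum_n v) (Cmod l) L); [|exact K|exact Hv].
intros n. unfold sum_n. eapply Rle_trans; [apply (norm_sum_n_m (V := C_NormedModule))|].
apply sum_n_m_le. intros k. apply H.
Qed.

Lemma Re_sum_n (u : nat -> C) (n : nat) : Re (sum_n u n) = sum_n (fun k => Re (u k)) n.
Proof.
induction n as [|n IH]; [rewrite !sum_O; reflexivity|].
rewrite !sum_Sn, <- IH. reflexivity.
Qed.

Lemma Im_sum_n (u : nat -> C) (n : nat) : Im (sum_n u n) = sum_n (fun k => Im (u k)) n.
Proof.
induction n as [|n IH]; [rewrite !sum_O; reflexivity|].
rewrite !sum_Sn, <- IH. reflexivity.
Qed.

(** Transfers to complex series the real results on sums and Cauchy products. *)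
Lemma is_series_Re_Im (u : nat -> C) (l : C) :
  is_series u l <->
  is_series (fun n => Re (u n)) (Re l) /\ is_series (fun n => Im (u n)) (Im l).
Proof.
split.
- intros H. split; unfold is_series.
  + apply filterlim_ext with (fun n => Re (sum_n u n)); [intros n; apply Re_sum_n|].
    exact (filterlim_comp _ _ _ _ _ _ _ _ H (continuous_fst (fst l) (snd l))).
  + apply filterlim_ext with (fun n => Im (sum_n u n)); [intros n; apply Im_sum_n|].
    exact (filterlim_comp _ _ _ _ _ _ _ _ H (continuous_snd (fst l) (snd l))).
- intros [H1 H2]. unfold is_series in *. apply filterlim_locally. intros eps.
  assert (K1 := proj1 (filterlim_locally _ _) H1 eps).
  assert (K2 := proj1 (filterlim_locally _ _) H2 eps).
  generalize (filter_and _ _ K1 K2). apply filter_imp. intros n [B1 B2].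
  rewrite <- Re_sum_n in B1. rewrite <- Im_sum_n in B2. split; assumption.
Qed.

Definition cps (a : nat -> C) (z l : C) : Prop := is_series (fun n => (a n * z ^ n)%C) l.

Lemma pow_n_Cpow (z : C) (n : nat) : @pow_n C_Ring z n = (z ^ n)%C.
Proof. induction n as [|n IH]; [reflexivity|]. simpl. rewrite <- IH. reflexivity. Qed.

Lemma is_pseries_cps (a : nat -> C) (z l : C) : is_pseries a z l <-> cps a z l.
Proof.
assert (E : forall n, (@pow_n C_Ring z n * a n)%C = (a n * z ^ n)%C)
  by (intros n; rewrite pow_n_Cpow; ring).
unfold is_pseries, cps. split; apply is_series_ext; intros n; [|symmetry]; exact (E n).
Qed.

Lemma cps_unique (a : nat -> C) (z l m : C) : cps a z l -> cps a z m -> l = m.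
Proof. intros H1 H2. exact (filterlim_locally_unique (V := C_NormedModule) _ _ _ H1 H2). Qed.

Lemma is_series_C_zero : is_series (fun _ : nat => RtoC 0) (RtoC 0).
Proof.
apply is_series_Re_Im. unfold Re, Im. simpl.
assert (H : is_series (fun _ : nat => 0) 0).
{ apply filterlim_ext with (fun _ => 0); [|apply filterlim_const].
  intros n. rewrite sum_n_const. ring. }
split; exact H.
Qed.

Lemma is_series_C_decr_1 (u : nat -> C) (l : C) :
  is_series (fun n => u (S n)) l -> is_series u (u 0%nat + l)%C.
Proof.
intros H. apply is_series_decr_1.
change (is_series (fun n => u (S n)) (u 0%nat + l + - u 0%nat)%C).
replace (u 0%nat + l + - u 0%nat)%C with l by ring. exact H.
Qed.

Lemma cps_0 (a : nat -> C) : cps a 0 (a 0%nat).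
Proof.
assert (H : is_series (fun n => (a (S n) * 0 ^ S n)%C) (RtoC 0)).
{ apply is_series_C_ext with (fun _ : nat => RtoC 0); [|apply is_series_C_zero].
  intros n. rewrite Cpow_S. ring. }
apply (is_series_C_decr_1 (fun n => (a n * 0 ^ n)%C)) in H.
simpl in H. replace (a 0%nat * 1 + 0)%C with (a 0%nat) in H by ring. exact H.
Qed.

Lemma cps_decr_1 (a : nat -> C) (z l : C) :
  cps (fun n => a (S n)) z l -> cps a z (a 0%nat + z * l)%C.
Proof.
intros H. apply (is_series_scal (V := C_NormedModule) z) in H.
assert (H' : is_series (fun n => (a (S n) * z ^ S n)%C) (z * l)%C).
{ revert H. apply is_series_C_ext. intros n.
  change (z * (a (S n) * z ^ n) = a (S n) * z ^ S n)%C. rewrite Cpow_S. ring. }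
apply (is_series_C_decr_1 (fun n => (a n * z ^ n)%C)) in H'.
simpl in H'. replace (a 0%nat * 1 + z * l)%C with (a 0%nat + z * l)%C in H' by ring. exact H'.
Qed.

(* Radius of convergence at least 1. *)
Definition disc_conv (a : nat -> C) : Prop :=
  forall x, 0 <= x < 1 -> Rbar_lt x (CV_radius (fun n => Cmod (a n))).

Lemma disc_conv_of_bounded (a : nat -> C) :
  (forall y, 0 <= y < 1 -> exists M, forall n, Cmod (a n) * y ^ n <= M) -> disc_conv a.
Proof.
intros H x Hx.
destruct (CV_radius_bounded (fun n => Cmod (a n))) as [U _].
(* Boundedness at y only shows that the radius is at least y, so a midpoint between x and 1 supplies
   the strict inequality. *)
apply Rbar_lt_le_trans with ((x + 1) / 2); [simpl; lra|].
apply U. destruct (H ((x + 1) / 2)) as [M HM]; [lra|]. exists M. intros n.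
rewrite Rabs_pos_eq; [apply HM|].
apply Rmult_le_pos; [apply Cmod_ge_0|apply pow_le; lra].
Qed.

Lemma disc_conv_of_coef_bounded (a : nat -> C) (M : R) :
  (forall n, Cmod (a n) <= M) -> disc_conv a.
Proof.
intros H. apply disc_conv_of_bounded. intros y Hy. exists M. intros n.
assert (P : 0 <= y ^ n) by (apply pow_le; lra).
assert (Q : y ^ n <= 1) by (rewrite <- (pow1 n); apply pow_incr; lra).
assert (A := H n). assert (B := Cmod_ge_0 (a n)). nra.
Qed.

(** At each y in [0, 1) the partial sums are bounded by some M, and a term is a difference of two
    consecutive ones, hence at most 2 M. *)
Lemma disc_conv_of_cps (a : nat -> C) (f : C -> C) :
  (forall z, Cmod z < 1 -> cps a z (f z)) -> disc_conv a.
Proof.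
intros H. apply disc_conv_of_bounded. intros y Hy.
assert (K : cps a (RtoC y) (f y)) by (apply H; rewrite Cmod_R, Rabs_pos_eq; lra).
destruct (filterlim_bounded (V := C_NormedModule) _ (ex_intro _ _ K)) as [M HM].
exists (2 * M). intros n.
replace (Cmod (a n) * y ^ n) with (Cmod (a n * RtoC y ^ n)).
2:{ rewrite Cmod_mult, Cmod_pow, Cmod_R, Rabs_pos_eq by lra. reflexivity. }
set (u := fun n => (a n * RtoC y ^ n)%C) in *.
change (Cmod (u n) <= 2 * M).
assert (HM' : forall n, Cmod (sum_n u n) <= M) by exact HM.
destruct n as [|n].
- assert (X := HM' O). rewrite sum_O in X. assert (P := Cmod_ge_0 (u O)). lra.
- assert (X := HM' n). assert (X' := HM' (S n)). rewrite sum_Sn in X'.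
  assert (T := Cmod_triangle (plus (sum_n u n) (u (S n))) (- sum_n u n)%C).
  rewrite Cmod_opp in T.
  replace (plus (sum_n u n) (u (S n)) + - sum_n u n)%C with (u (S n)) in T; [lra|].
  change (u (S n) = sum_n u n + u (S n) + - sum_n u n)%C. ring.
Qed.

Lemma disc_conv_ex_series (a : nat -> C) (x : R) :
  disc_conv a -> 0 <= x < 1 -> ex_series (fun n => Cmod (a n) * x ^ n).
Proof.
intros H Hx. assert (K := CV_disk_inside (fun n => Cmod (a n)) x).
rewrite Rabs_pos_eq in K by lra.
apply ex_series_ext with (2 := K (H x Hx)). intros n. apply Rabs_pos_eq.
apply Rmult_le_pos; [apply Cmod_ge_0|apply pow_le; lra].
Qed.

Lemma disc_conv_cps (a : nat -> C) (z : C) :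
  disc_conv a -> Cmod z < 1 -> exists l, cps a z l.
Proof.
intros H Hz.
assert (E : ex_series (fun n => Cmod (a n) * Cmod z ^ n)).
{ apply disc_conv_ex_series; [exact H|]. split; [apply Cmod_ge_0|exact Hz]. }
assert (X := ex_series_le (V := C_CompleteNormedModule) (fun n => (a n * z ^ n)%C) _
  (fun n => Req_le _ _ (eq_trans (Cmod_mult _ _) (f_equal _ (Cmod_pow z n)))) E).
exact X.
Qed.

Definition cderiv_coef (a : nat -> C) (n : nat) : C := (RtoC (INR (S n)) * a (S n))%C.

Lemma disc_conv_deriv (a : nat -> C) : disc_conv a -> disc_conv (cderiv_coef a).
Proof.
intros H x Hx. specialize (H x Hx). rewrite <- CV_radius_derive in H.
rewrite CV_radius_ext with (b := fun n => Cmod (cderiv_coef a n)) in H; [exact H|].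
intros n. unfold PS_derive, cderiv_coef. rewrite Cmod_mult, Cmod_R, Rabs_pos_eq; [reflexivity|].
apply pos_INR.
Qed.

(* The Taylor remainder of [z ^ n] is a polynomial in [z], [h] with
   nonnegative coefficients, so its modulus is bounded by its value at
   [Cmod z], [Cmod h]. *)
Lemma pow_remainder_le (z h : C) (n : nat) :
  Cmod ((z + h) ^ n - z ^ n - RtoC (INR n) * z ^ pred n * h)%C <=
  (Cmod z + Cmod h) ^ n - Cmod z ^ n - INR n * Cmod z ^ pred n * Cmod h.
Proof.
set (x := Cmod z). set (y := Cmod h).
assert (X : 0 <= x) by apply Cmod_ge_0. assert (Y : 0 <= y) by apply Cmod_ge_0.
destruct n as [|n].
{ replace ((z + h) ^ 0 - z ^ 0 - RtoC (INR 0) * z ^ pred 0 * h)%C with (RtoC 0) by (simpl; ring).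
  rewrite Cmod_0. simpl. lra. }
change (pred (S n)) with n. induction n as [|n IH].
- simpl INR. rewrite !Cpow_1_r.
  replace (z + h - z - 1 * z ^ 0 * h)%C with (RtoC 0) by (simpl; ring).
  rewrite Cmod_0. simpl. lra.
- replace ((z + h) ^ S (S n) - z ^ S (S n) - RtoC (INR (S (S n))) * z ^ S n * h)%C
    with ((z + h) * ((z + h) ^ S n - z ^ S n - RtoC (INR (S n)) * z ^ n * h)
          + RtoC (INR (S n)) * z ^ n * (h * h))%C
    by (rewrite (S_INR (S n)), RtoC_plus, !Cpow_S; ring).
  replace ((x + y) ^ S (S n) - x ^ S (S n) - INR (S (S n)) * x ^ S n * y)
    with ((x + y) * ((x + y) ^ S n - x ^ S n - INR (S n) * x ^ n * y)
          + INR (S n) * x ^ n * (y * y))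
    by (rewrite (S_INR (S n)); simpl; ring).
  eapply Rle_trans; [apply Cmod_triangle|]. apply Rplus_le_compat.
  + rewrite Cmod_mult. apply Rmult_le_compat; try apply Cmod_ge_0; [apply Cmod_triangle|exact IH].
  + rewrite !Cmod_mult, Cmod_pow, Cmod_R, Rabs_pos_eq by apply pos_INR. fold x y. lra.
Qed.

(** The additional term at n = 0 vanishes through its factor [INR 0], so the value of [pred 0] is
    harmless. *)
Lemma cps_deriv_shift (a : nat -> C) (z l : C) : cps (cderiv_coef a) z l ->
  is_series (fun n => (RtoC (INR n) * a n * z ^ pred n)%C) l.
Proof.
intros H. apply (is_series_C_decr_1 (fun n => (RtoC (INR n) * a n * z ^ pred n)%C)) in H.
simpl in H. replace (0 * a 0%nat * 1 + l)%C with l in H by ring. exact H.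
Qed.

(** Method of majorants: the first-order remainder of the complex series at z, h is bounded termwise
    by that of the real series with coefficients |a_n| at |z|, |h|, and real power series are known
    to be differentiable. *)
Lemma cps_cdiff (a : nat -> C) (f f' : C -> C) :
  (forall z, Cmod z < 1 -> cps a z (f z)) ->
  (forall z, Cmod z < 1 -> cps (cderiv_coef a) z (f' z)) ->
  forall z, Cmod z < 1 -> cdiff f z (f' z).
Proof.
intros Hf Hf' z Hz. assert (DC := disc_conv_of_cps a f Hf).
assert (X := Cmod_ge_0 z). set (x := Cmod z) in *.
set (p := fun n => Cmod (a n)).
assert (D := is_derive_PSeries p x).
rewrite Rabs_pos_eq in D by exact X. specialize (D (DC x (conj X Hz))).
destruct D as [_ D]. specialize (D x (fun P HP => HP)).
apply cdiff_of_bound. intros e He. destruct (D (mkposreal e He)) as [d Hd].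
exists (Rmin d (1 - x)). split; [apply Rmin_pos; [apply cond_pos|lra]|].
intros h Hh. assert (Y := Cmod_ge_0 h). set (y := Cmod h) in *.
assert (H1 := Rlt_le_trans _ _ _ Hh (Rmin_l _ _)).
assert (H2 := Rlt_le_trans _ _ _ Hh (Rmin_r _ _)).
assert (PSx : forall t, 0 <= t < 1 -> is_series (fun n => p n * t ^ n) (PSeries p t)).
{ intros t Ht. apply (proj1 (is_pseries_R p t _)). apply (PSeries_correct p t).
  apply (CV_radius_inside p t). rewrite Rabs_pos_eq by lra. apply DC, Ht. }
assert (PSd : is_series (fun n => INR n * p n * x ^ pred n) (PSeries (PS_derive p) x)).
{ assert (Q : is_series (fun n => PS_derive p n * x ^ n) (PSeries (PS_derive p) x)).
  { apply (proj1 (is_pseries_R (PS_derive p) x _)). apply (PSeries_correct (PS_derive p) x).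
    apply (CV_radius_inside (PS_derive p) x). rewrite CV_radius_derive, Rabs_pos_eq by lra. apply DC. lra. }
  apply is_series_decr_1.
  change (is_series (fun n => PS_derive p n * x ^ n)
    (PSeries (PS_derive p) x + - (INR 0 * p 0%nat * x ^ pred 0))).
  replace (PSeries (PS_derive p) x + - (INR 0 * p 0%nat * x ^ pred 0))
    with (PSeries (PS_derive p) x) by (simpl; ring).
  exact Q. }
assert (Zh : Cmod (z + h) < 1).
{ eapply Rle_lt_trans; [apply Cmod_triangle|]. fold x y. lra. }
assert (Main : Cmod (f (z + h)%C - f z - f' z * h) <=
  PSeries p (x + y) - PSeries p x - y * PSeries (PS_derive p) x).
{ assert (S1 := is_series_minus _ _ _ _
    (is_series_minus _ _ _ _ (Hf _ Zh) (Hf _ Hz))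
    (is_series_scal (V := C_NormedModule) h _ _ (cps_deriv_shift _ _ _ (Hf' _ Hz)))).
  assert (S2 := is_series_minus _ _ _ _
    (is_series_minus _ _ _ _ (PSx (x + y) ltac:(lra)) (PSx x ltac:(lra)))
    (is_series_scal (V := R_NormedModule) y _ _ PSd)).
  replace (f (z + h) - f z - f' z * h)%C with (f (z + h) + - f z + - (h * f' z))%C by ring.
  apply (is_series_Cmod_le _ _ _ _ S1 S2). intros n.
  change (Cmod (a n * (z + h) ^ n + - (a n * z ^ n) + - (h * (RtoC (INR n) * a n * z ^ pred n)))
    <= p n * (x + y) ^ n + - (p n * x ^ n) + - (y * (INR n * p n * x ^ pred n))).
  replace (a n * (z + h) ^ n + - (a n * z ^ n) + - (h * (RtoC (INR n) * a n * z ^ pred n)))%C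
    with (a n * ((z + h) ^ n - z ^ n - RtoC (INR n) * z ^ pred n * h))%C by ring.
  replace (p n * (x + y) ^ n + - (p n * x ^ n) + - (y * (INR n * p n * x ^ pred n)))
    with (p n * ((x + y) ^ n - x ^ n - INR n * x ^ pred n * y)) by ring.
  rewrite Cmod_mult. apply Rmult_le_compat_l; [apply Cmod_ge_0|apply pow_remainder_le]. }
eapply Rle_trans; [exact Main|].
assert (B : Rabs (x + y - x) < d) by (replace (x + y - x) with y by ring; rewrite Rabs_pos_eq; lra).
specialize (Hd (x + y) B).
change (Rabs (PSeries p (x + y) - PSeries p x - (x + y - x) * PSeries (PS_derive p) x)
  <= e * Rabs (x + y - x)) in Hd.
replace (x + y - x) with y in Hd by ring. rewrite (Rabs_pos_eq y) in Hd by exact Y.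
eapply Rle_trans; [apply Rle_abs|exact Hd].
Qed.

Lemma is_series_C_mult (u v : nat -> C) (l m : C) :
  is_series u l -> is_series v m ->
  ex_series (fun n => Cmod (u n)) -> ex_series (fun n => Cmod (v n)) ->
  is_series (fun n => sum_n (fun k => (u k * v (n - k)%nat)%C) n) (l * m)%C.
Proof.
intros Hu Hv Au Av.
assert (AR : forall w : nat -> C, ex_series (fun n => Cmod (w n)) -> ex_series (fun n => Rabs (Re (w n)))).
{ intros w. apply (ex_series_le (V := R_CompleteNormedModule) (fun n => Rabs (Re (w n)))).
  intros n. change (Rabs (Rabs (Re (w n))) <= Cmod (w n)). rewrite Rabs_Rabsolu. apply re_le_Cmod. }
assert (AI : forall w : nat -> C, ex_series (fun n => Cmod (w n)) -> ex_series (fun n => Rabs (Im (w n)))).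
{ intros w. apply (ex_series_le (V := R_CompleteNormedModule) (fun n => Rabs (Im (w n)))).
  intros n. change (Rabs (Rabs (Im (w n))) <= Cmod (w n)). rewrite Rabs_Rabsolu.
  eapply Rle_trans; [apply Rmax_r|apply Rmax_Cmod]. }
apply is_series_Re_Im in Hu. destruct Hu as [U1 U2].
apply is_series_Re_Im in Hv. destruct Hv as [V1 V2].
apply is_series_Re_Im. split.
- replace (Re (l * m)%C) with (Re l * Re m + - (Im l * Im m)) by (unfold Re, Im; simpl; ring).
  apply is_series_ext with (2 := is_series_minus _ _ _ _
    (is_series_mult _ _ _ _ U1 V1 (AR _ Au) (AR _ Av))
    (is_series_mult _ _ _ _ U2 V2 (AI _ Au) (AI _ Av))).
  intros n. rewrite Re_sum_n, sum_n_Reals.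
  transitivity (sum_f_R0 (fun k => Re (u k) * Re (v (n - k)%nat)) n
    - sum_f_R0 (fun k => Im (u k) * Im (v (n - k)%nat)) n); [reflexivity|].
  rewrite <- minus_sum. apply sum_eq. intros k _. reflexivity.
- replace (Im (l * m)%C) with (Re l * Im m + Im l * Re m) by (unfold Re, Im; simpl; ring).
  apply is_series_ext with (2 := is_series_plus _ _ _ _
    (is_series_mult _ _ _ _ U1 V2 (AR _ Au) (AI _ Av))
    (is_series_mult _ _ _ _ U2 V1 (AI _ Au) (AR _ Av))).
  intros n. rewrite Im_sum_n, <- !sum_n_Reals, <- sum_n_plus. apply sum_n_ext.
  intros k. reflexivity.
Qed.

Lemma cps_mult (a b : nat -> C) (z l m : C) :
  disc_conv a -> disc_conv b -> Cmod z < 1 -> cps a z l -> cps b z m ->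
  cps (fun n => sum_n (fun k => (a k * b (n - k)%nat)%C) n) z (l * m)%C.
Proof.
intros Da Db Hz Ha Hb.
assert (A : forall c, disc_conv c -> ex_series (fun n => Cmod (c n * z ^ n))).
{ intros c Dc. apply ex_series_ext with (2 := disc_conv_ex_series c (Cmod z) Dc (conj (Cmod_ge_0 z) Hz)).
  intros n. rewrite Cmod_mult, Cmod_pow. reflexivity. }
apply is_series_C_ext with (2 := is_series_C_mult _ _ _ _ Ha Hb (A _ Da) (A _ Db)).
intros n. change C with (Ring.sort C_Ring).
transitivity (mult (sum_n (fun k => (a k * b (n - k)%nat)%C) n) (z ^ n)%C); [|reflexivity].
rewrite <- (sum_n_mult_r (K := C_Ring)). apply sum_n_ext_loc. intros k Hk.
change ((a k * z ^ k * (b (n - k)%nat * z ^ (n - k)))%C = (a k * b (n - k)%nat * z ^ n)%C).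
replace (z ^ n)%C with (z ^ k * z ^ (n - k))%C; [ring|].
rewrite <- Cpow_add_r. f_equal. lia.
Qed.

(** [Series] is total, which makes the sum a function on all of C without convergence proofs in its
    type. *)
Definition csum (a : nat -> C) (z : C) : C :=
  (Series (fun n => Re (a n * z ^ n)%C), Series (fun n => Im (a n * z ^ n)%C)).

Lemma csum_cps (a : nat -> C) : disc_conv a ->
  forall z, Cmod z < 1 -> cps a z (csum a z).
Proof.
intros H z Hz. destruct (disc_conv_cps a z H Hz) as [l Hl].
replace (csum a z) with l; [exact Hl|].
apply is_series_Re_Im in Hl. destruct Hl as [H1 H2].
apply injective_projections; symmetry; apply is_series_unique; assumption.
Qed.

Lemma csum_0 (a : nat -> C) : disc_conv a -> csum a 0%C = a 0%nat.
Proof.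
intros H. apply (cps_unique a (RtoC 0)); [|apply cps_0].
apply csum_cps; [exact H|]. rewrite Cmod_0. exact Rlt_0_1.
Qed.

Lemma csum_cdiff (a : nat -> C) : disc_conv a ->
  forall z, Cmod z < 1 -> cdiff (csum a) z (csum (cderiv_coef a) z).
Proof.
intros H. apply cps_cdiff with a; apply csum_cps; [exact H|]. apply disc_conv_deriv, H.
Qed.

(** * Univalence *)

Lemma class_A_at_0 (f : C -> C) : class_A f -> f 0%C = 0%C /\ cdiff f 0 1.
Proof.
intros [_ [a [A0 [A1 H]]]].
assert (Hc : forall z, Cmod z < 1 -> cps a z (f z)).
{ intros z Hz. exact (proj1 (is_pseries_cps a z _) (H z Hz)). }
assert (DC := disc_conv_of_cps a f Hc).
assert (Z : Cmod 0 < 1) by (rewrite Cmod_0; lra).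
split.
- assert (E := cps_0 a). rewrite A0 in E. exact (cps_unique _ _ _ _ (Hc _ Z) E).
- eapply cdiff_val.
  + apply (cps_cdiff a f (csum (cderiv_coef a)) Hc); [|exact Z].
    apply csum_cps, disc_conv_deriv, DC.
  + rewrite csum_0 by (apply disc_conv_deriv, DC). unfold cderiv_coef. rewrite A1. simpl. ring.
Qed.

Lemma class_A_cdiff (f : C -> C) (z : C) : class_A f -> Cmod z < 1 -> cdiff f z (C_derive f z).
Proof. intros [H _] Hz. apply ex_derive_cdiff, H, Hz. Qed.

Lemma Re_Casinh_bound (w : C) (d : R) :
  Cmod w < 1 -> 0 <= d -> Cmod w < sinh d -> Rabs (Re (Casinh w)) < d.
Proof.
intros Hw Hd H. assert (E := Casinh_mod w Hw). set (a := Re (Casinh w)) in *.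
set (b := Im (Casinh w)) in *.
destruct (Rlt_le_dec (Rabs a) d) as [L|L]; [exact L|exfalso].
assert (S : sinh d <= sinh (Rabs a)).
{ destruct L as [L|L]; [left; apply sinh_lt, L|rewrite L; lra]. }
assert (Q : sinh (Rabs a) * sinh (Rabs a) = sinh a * sinh a).
{ unfold Rabs. destruct (Rcase_abs a); [rewrite sinh_opp|]; ring. }
assert (P := Cmod_ge_0 w). assert (Y := Rle_0_sqr (sin b)). unfold Rsqr in Y. nra.
Qed.

(** Since 1 <= sinh 1. In terms of p = 1 + asinh w this is Re p > 0, the input for univalence. *)
Lemma Re_Casinh_gt_m1 (w : C) : Cmod w < 1 -> -1 < Re (Casinh w).
Proof.
intros Hw. assert (S := sinh_ge_id 1 ltac:(lra)).
assert (H := Re_Casinh_bound w 1 Hw ltac:(lra) ltac:(lra)). apply Rabs_lt_between in H. lra.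
Qed.

(** |sin b| <= |w| by [Casinh_mod], then Jordan. The linear dependence on |w| makes Im (asinh w) / t
    bounded along a ray. *)
Lemma Im_Casinh_bound (w : C) : Cmod w < 1 -> Rabs (Im (Casinh w)) <= PI / 2 * Cmod w.
Proof.
intros Hw. destruct (Casinh_spec w Hw) as [B _]. assert (E := Casinh_mod w Hw).
eapply Rle_trans; [apply jordan_abs; lra|]. assert (P := PI_RGT_0).
apply Rmult_le_compat_l; [lra|].
assert (Q := Rabs_sqr (sin (Im (Casinh w)))). assert (Q' := Rabs_pos (sin (Im (Casinh w)))).
assert (P' := Cmod_ge_0 w). assert (Y := Rle_0_sqr (sinh (Re (Casinh w)))). unfold Rsqr in Y. nra.
Qed.

(** t0 is the supremum of the t such that X is positive on all of [0, t]. *)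
Lemma first_zero (X : R -> R) :
  (forall t, 0 <= t <= 1 -> continuity_pt X t) -> 0 < X 0 -> X 1 <= 0 ->
  exists t0, 0 < t0 <= 1 /\ X t0 = 0 /\ forall t, 0 <= t < t0 -> 0 < X t.
Proof.
intros HC H0 H1.
set (E := fun t => 0 <= t <= 1 /\ forall u, 0 <= u <= t -> 0 < X u).
(* [continuity_pt] excludes the point itself; this form does not. *)
assert (CP : forall t, 0 <= t <= 1 -> forall e, 0 < e -> exists d, 0 < d /\
  forall u, Rabs (u - t) < d -> Rabs (X u - X t) < e).
{ intros t Ht e He. destruct (HC t Ht e He) as [d [Hd Hu]]. exists d. split; [exact Hd|].
  intros u Hut. destruct (Req_dec u t) as [->|N].
  - unfold Rminus. rewrite Rplus_opp_r, Rabs_R0. exact He.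
  - apply Hu. split; [split; [exact I|congruence]|exact Hut]. }
assert (E0 : E 0).
{ split; [lra|]. intros u Hu. replace u with 0 by lra. exact H0. }
destruct (completeness E) as [t0 [UB LUB]].
{ exists 1. intros t [Ht _]. lra. }
{ exists 0. exact E0. }
assert (B0 : 0 <= t0) by (apply UB, E0).
assert (B1 : t0 <= 1) by (apply LUB; intros t [Ht _]; lra).
assert (Below : forall t, 0 <= t < t0 -> 0 < X t).
{ intros t Ht. destruct (Rlt_le_dec 0 (X t)) as [L|L]; [exact L|exfalso].
  assert (t0 <= t); [|lra]. apply LUB. intros s [Hs Hp].
  destruct (Rle_lt_dec s t) as [|K]; [assumption|exfalso]. specialize (Hp t). lra. }
assert (Z : X t0 = 0).
{ destruct (Rtotal_order (X t0) 0) as [L|[L|L]]; [exfalso|exact L|exfalso].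
  - destruct (CP t0 (conj B0 B1) (- X t0)) as [d [Hd Hu]]; [lra|].
    assert (P : 0 < t0) by (destruct B0 as [|e]; [assumption|rewrite <- e in L; lra]).
    set (u := Rmax 0 (t0 - d / 2)).
    assert (Bu : 0 <= u < t0 /\ t0 - d / 2 <= u).
    { unfold u. split; [split; [apply Rmax_l|apply Rmax_lub_lt; lra]|apply Rmax_r]. }
    assert (X1 := Below u (proj1 Bu)). assert (X2 := Hu u).
    assert (A : Rabs (u - t0) < d) by (apply Rabs_lt_between; lra).
    specialize (X2 A). apply Rabs_lt_between in X2. lra.
  - destruct (CP t0 (conj B0 B1) (X t0)) as [d [Hd Hu]]; [lra|].
    assert (P : t0 < 1) by (destruct B1 as [|e]; [assumption|rewrite e in L; lra]).
    set (v := Rmin 1 (t0 + d / 2)).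
    assert (Bv : t0 < v <= 1 /\ v <= t0 + d / 2).
    { unfold v. split; [split; [apply Rmin_glb_lt; lra|apply Rmin_l]|apply Rmin_r]. }
    assert (E v); [|assert (K := UB v H); lra].
    split; [lra|]. intros u Hu'. destruct (Rlt_le_dec u t0) as [K|K]; [apply Below; lra|].
    assert (A : Rabs (u - t0) < d) by (apply Rabs_lt_between; lra).
    specialize (Hu u A). apply Rabs_lt_between in Hu. lra. }
exists t0. split; [|split; [exact Z|exact Below]].
split; [|exact B1]. destruct B0 as [|e]; [assumption|rewrite <- e in Z; lra].
Qed.

Lemma nonneg_left_limit (g : R -> R) (t0 : R) :
  0 < t0 -> continuity_pt g t0 -> (forall t, 0 < t < t0 -> 0 <= g t) -> 0 <= g t0.
Proof.
intros P HC H. destruct (Rle_lt_dec 0 (g t0)) as [L|L]; [exact L|exfalso].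
destruct (HC (- g t0)) as [d [Hd Hu]]; [lra|].
set (u := Rmax (t0 / 2) (t0 - d / 2)).
assert (Bu : t0 / 2 <= u < t0 /\ t0 - d / 2 <= u).
{ unfold u. split; [split; [apply Rmax_l|apply Rmax_lub_lt; lra]|apply Rmax_r]. }
assert (A : Rabs (u - t0) < d) by (apply Rabs_lt_between; lra).
assert (X2 := Hu u (conj (conj I (fun e => Rlt_not_eq _ _ (proj2 (proj1 Bu)) (eq_sym e))) A)).
assert (X3 : Rabs (g u - g t0) < - g t0) by exact X2.
apply Rabs_lt_between in X3. assert (X1 := H u). lra.
Qed.

Lemma continuity_Re_Im_line (g : C -> C) (a b : C) (t : R) :
  ccont g (a + RtoC t * b)%C ->
  continuity_pt (fun u => Re (g (a + RtoC u * b)%C)) t /\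
  continuity_pt (fun u => Im (g (a + RtoC u * b)%C)) t.
Proof.
intros H. assert (B := Cmod_ge_0 b).
assert (K : forall e, e > 0 -> exists d, d > 0 /\ forall u, Rabs (u - t) < d ->
  Cmod (g (a + RtoC u * b) - g (a + RtoC t * b))%C < e).
{ intros e He. destruct (H e He) as [d [Hd Hw]]. exists (d / (Cmod b + 1)).
  split; [apply Rdiv_lt_0_compat; lra|]. intros u Hu. apply Hw.
  replace (a + RtoC u * b - (a + RtoC t * b))%C with (RtoC (u - t) * b)%C
    by (rewrite RtoC_minus; ring).
  rewrite Cmod_mult, Cmod_R.
  apply Rle_lt_trans with (Rabs (u - t) * (Cmod b + 1)).
  { apply Rmult_le_compat_l; [apply Rabs_pos|lra]. }
  apply Rmult_lt_compat_r with (r := Cmod b + 1) in Hu; [|lra].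
  replace (d / (Cmod b + 1) * (Cmod b + 1)) with d in Hu by (field; lra). exact Hu. }
split; intros e He; destruct (K e He) as [d [Hd Hu]]; exists d; (split; [exact Hd|]);
  intros u [_ Hut]; specialize (Hu u Hut); (eapply Rle_lt_trans; [|exact Hu]).
- apply (re_le_Cmod (g (a + RtoC u * b) - g (a + RtoC t * b))%C).
- eapply Rle_trans; [|apply Rmax_Cmod]. apply Rmax_r.
Qed.

(** * The function f(z)/z and its logarithm *)

Definition quot_id (f : C -> C) (z : C) : C := if Ceq_dec z 0 then RtoC 1 else (f z / z)%C.

Lemma quot_id_mult (f : C -> C) (z : C) : f 0%C = 0%C -> f z = (z * quot_id f z)%C.
Proof.
intros H. unfold quot_id. destruct (Ceq_dec z 0) as [->|N]; [rewrite H; ring|field; exact N].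
Qed.

Lemma cdiff_quot_id (f : C -> C) (z : C) :
  class_A f -> zdlog_defined f -> Cmod z < 1 -> z <> 0%C ->
  cdiff (quot_id f) z (quot_id f z * (zdlog f z - 1) / z)%C.
Proof.
intros HA HD Hz N.
assert (Z : 0 < Cmod z) by (apply Cmod_gt_0, N).
apply (cdiff_ext_loc (fun w => f w / w)%C _ z _ (Cmod z) Z).
{ intros w Hw. unfold quot_id. destruct (Ceq_dec w 0) as [->|]; [exfalso|reflexivity].
  replace (0 - z)%C with (- z)%C in Hw by ring. rewrite Cmod_opp in Hw. lra. }
assert (NF := HD z Hz N).
eapply cdiff_val.
- apply (cdiff_div f (fun w => w)); [apply class_A_cdiff; assumption|apply cdiff_id|exact N].
- unfold quot_id, zdlog. destruct (Ceq_dec z 0); [contradiction|]. field. split; assumption.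
Qed.

Lemma ccont_quot_id (f : C -> C) (z : C) :
  class_A f -> zdlog_defined f -> Cmod z < 1 -> ccont (quot_id f) z.
Proof.
intros HA HD Hz. destruct (Ceq_dec z 0) as [->|N].
- destruct (class_A_at_0 f HA) as [F0 [p [P1 [P2 P3]]]].
  (* As f 0 = 0, the slope function of f at 0 coincides with f(w)/w off 0 and equals 1 at 0, so it
     is [quot_id f]. *)
  apply ccont_ext_loc with p 1; [lra| |exact P1].
  intros w _. unfold quot_id. destruct (Ceq_dec w 0) as [->|N]; [exact P2|].
  rewrite (P3 w), F0. field. exact N.
- eapply cdiff_ccont, cdiff_quot_id; assumption.
Qed.

Lemma quot_id_neq_0 (f : C -> C) (z : C) :
  zdlog_defined f -> Cmod z < 1 -> quot_id f z <> 0%C.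
Proof.
intros HD Hz. unfold quot_id. destruct (Ceq_dec z 0) as [->|N].
- intros E. injection E. lra.
- intros E. apply (HD z Hz N).
  replace (f z) with (f z / z * z)%C by (field; exact N). rewrite E. ring.
Qed.

(* This gives a logarithm of f(z)/z without integration.  Along a ray,
   arg (f(z)/z) has derivative Im (asinh w) / t, of modulus at most
   (PI/2) |z|, so arg (f(z)/z) stays below PI/2. *)
Lemma quot_id_half_plane (f w : C -> C) (z : C) :
  class_A f -> zdlog_defined f ->
  (forall u, Cmod u < 1 -> Cmod (w u) <= Cmod u) ->
  (forall u, Cmod u < 1 -> zdlog f u = (1 + Casinh (w u))%C) ->
  Cmod z < 1 -> 0 < Re (quot_id f z).
Proof.
intros HA HD Hw Hp Hz. destruct (Ceq_dec z 0) as [->|N].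
{ unfold quot_id. destruct (Ceq_dec 0 0); [unfold Re; simpl; lra|congruence]. }
destruct (Rlt_le_dec 0 (Re (quot_id f z))) as [L|L]; [exact L|exfalso].
assert (Z0 := Cmod_ge_0 z). assert (PP := PI_RGT_0).
set (X := fun t => Re (quot_id f (0 + RtoC t * z)%C)).
set (Y := fun t => Im (quot_id f (0 + RtoC t * z)%C)).
assert (M : forall t, 0 <= t <= 1 -> Cmod (0 + RtoC t * z) = t * Cmod z).
{ intros t Ht. rewrite Cplus_0_l, Cmod_mult, Cmod_R, Rabs_pos_eq by lra. reflexivity. }
assert (D1 : forall t, 0 <= t <= 1 -> Cmod (0 + RtoC t * z) < 1).
{ intros t Ht. rewrite M by exact Ht. nra. }
assert (CXY : forall t, 0 <= t <= 1 -> continuity_pt X t /\ continuity_pt Y t).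
{ intros t Ht. apply continuity_Re_Im_line, ccont_quot_id; [exact HA|exact HD|apply D1, Ht]. }
assert (Q0 : quot_id f (0 + RtoC 0 * z)%C = 1%C).
{ replace (0 + RtoC 0 * z)%C with (RtoC 0) by ring. unfold quot_id.
  destruct (Ceq_dec 0 0); [reflexivity|congruence]. }
assert (X0 : X 0 = 1) by (unfold X; rewrite Q0; reflexivity).
assert (Y0 : Y 0 = 0) by (unfold Y; rewrite Q0; reflexivity).
destruct (first_zero X) as [t0 [Ht0 [Zt0 Pos]]].
{ intros t Ht. apply CXY, Ht. }
{ lra. }
{ unfold X. replace (0 + RtoC 1 * z)%C with z by ring. exact L. }
(* Strictly below PI/2 because |z| < 1, so tan K is finite and the sector |arg| <= K is closed and
   proper. *)
set (K := PI / 2 * Cmod z).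
assert (HK : 0 <= K < PI / 2) by (unfold K; nra).
assert (Th : forall t, 0 < t < t0 -> Rabs (atan (Y t / X t)) <= K).
{ intros t Ht.
  set (b := fun u => Im (Casinh (w (0 + RtoC u * z)%C))).
  destruct (MVT_gen (fun u => atan (Y u / X u)) 0 t (fun u => b u / u)) as [c [Hc E]].
  - intros u. rewrite Rmin_left, Rmax_right by lra. intros Hu.
    assert (Du : Cmod (0 + RtoC u * z) < 1) by (apply D1; lra).
    assert (Nu : (0 + RtoC u * z)%C <> 0%C).
    { rewrite Cplus_0_l. apply Cmult_neq_0; [|exact N]. intros e. injection e. lra. }
    assert (DQ := cdiff_quot_id f _ HA HD Du Nu).
    assert (DX := is_derive_Re_line _ _ _ _ _ DQ).
    assert (DY := is_derive_Im_line _ _ _ _ _ DQ).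
    assert (XP : 0 < X u) by (apply Pos; lra).
    fold X in DX. fold Y in DY.
    (* Along the ray q = f(z)/z has logarithmic derivative (p - 1)/u = s/u; its imaginary part is
       the derivative of the argument. *)
    assert (ED : (quot_id f (0 + RtoC u * z) * (zdlog f (0 + RtoC u * z) - 1) / (0 + RtoC u * z) * z
      = quot_id f (0 + RtoC u * z) * Casinh (w (0 + RtoC u * z)%C) * RtoC (/ u))%C).
    { rewrite (Hp _ Du), RtoC_inv by lra. field. split; [intros e; injection e; lra|exact N]. }
    rewrite ED in DX, DY.
    set (s := Casinh (w (0 + RtoC u * z)%C)) in *.
    set (q := quot_id f (0 + RtoC u * z)%C) in *.
    assert (EX : Re (q * s * RtoC (/ u))%C = (X u * Re s - Y u * Im s) / u).
    { change (X u) with (Re q). change (Y u) with (Im q). unfold Re, Im. simpl. field. lra. }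
    assert (EY : Im (q * s * RtoC (/ u))%C = (X u * Im s + Y u * Re s) / u).
    { change (X u) with (Re q). change (Y u) with (Im q). unfold Re, Im. simpl. field. lra. }
    rewrite EX in DX. rewrite EY in DY.
    assert (DT : is_derive (fun v => Y v / X v) u
      (((X u * Im s + Y u * Re s) / u * X u - Y u * ((X u * Re s - Y u * Im s) / u)) / X u ^ 2)).
    { apply is_derive_div; [exact DY|exact DX|lra]. }
    assert (DA : is_derive atan (Y u / X u) (/ (1 + (Y u / X u) ^ 2))).
    { apply is_derive_Reals. exact (derivable_pt_lim_atan (Y u / X u)). }
    assert (R := is_derive_comp atan (fun v => Y v / X v) u _ _ DA DT).
    replace (b u / u) with (scal (((X u * Im s + Y u * Re s) / u * X u - Y u * ((X u * Re s - Y u * Im s) / u)) / X u ^ 2)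
      (/ (1 + (Y u / X u) ^ 2))); [exact R|].
    change (((X u * Im s + Y u * Re s) / u * X u - Y u * ((X u * Re s - Y u * Im s) / u)) / X u ^ 2
      * (/ (1 + (Y u / X u) ^ 2)) = Im s / u).
    field. assert (S1 := Rle_0_sqr (Y u)). unfold Rsqr in S1. repeat split; nra.
  - intros u. rewrite Rmin_left, Rmax_right by lra. intros Hu.
    apply (continuity_pt_comp (fun u => Y u / X u) atan).
    + apply continuity_pt_div; [apply CXY; lra|apply CXY; lra|].
      assert (XP : 0 < X u) by (apply Pos; lra). lra.
    + apply derivable_continuous_pt, derivable_pt_atan.
  - rewrite Rmin_left, Rmax_right in Hc by lra.
    cbv beta in E. rewrite Y0, X0 in E.
    replace (0 / 1) with 0 in E by field. rewrite atan_0, !Rminus_0_r in E. rewrite E.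
    destruct (Req_dec c 0) as [C0|C0].
    { (* the mean value point may be the endpoint, where b c / c is 0 / 0 *)
      unfold b. rewrite C0. unfold Rdiv.
      assert (W0 : w (0 + RtoC 0 * z)%C = 0%C).
      { apply Cmod_eq_0. assert (T := Hw (0 + RtoC 0 * z)%C (D1 0 ltac:(lra))).
        rewrite M in T by lra. assert (T' := Cmod_ge_0 (w (0 + RtoC 0 * z)%C)). lra. }
      rewrite W0, Casinh_0. unfold Im. simpl. rewrite !Rmult_0_l, Rabs_R0. lra. }
    assert (Dc : Cmod (0 + RtoC c * z) < 1) by (apply D1; lra).
    assert (Bc : Rabs (b c) <= K * c).
    { unfold b. eapply Rle_trans; [apply Im_Casinh_bound; assert (T := Hw _ Dc); lra|].
      assert (T := Hw _ Dc). rewrite M in T by lra. unfold K.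
      replace (PI / 2 * Cmod z * c) with (PI / 2 * (c * Cmod z)) by ring.
      apply Rmult_le_compat_l; [lra|exact T]. }
    assert (Pc : 0 < c) by lra.
    unfold Rdiv. rewrite !Rabs_mult, Rabs_inv, (Rabs_pos_eq c), (Rabs_pos_eq t) by lra.
    apply Rle_trans with (K * c * / c * t).
    + apply Rmult_le_compat_r; [lra|]. apply Rmult_le_compat_r; [|exact Bc].
      left. apply Rinv_0_lt_compat, Pc.
    + replace (K * c * / c * t) with (K * t) by (field; lra). nra. }
(* The sector condition written as |Y| <= tan K * X survives the limit t -> t0; there X = 0 forces Y
   = 0, against the nonvanishing of f(z)/z. *)
assert (TB : forall t, 0 < t < t0 -> - (tan K * X t) <= Y t <= tan K * X t).
{ intros t Ht. assert (XP : 0 < X t) by (apply Pos; lra).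
  assert (A := Th t Ht). apply Rabs_le_between in A.
  assert (V : Y t = Y t / X t * X t) by (field; lra).
  set (v := Y t / X t) in *. rewrite V.
  assert (TK : atan (tan K) = K) by (apply atan_tan; lra).
  assert (v <= tan K).
  { destruct (Rle_lt_dec v (tan K)) as [|G]; [assumption|exfalso].
    apply atan_increasing in G. lra. }
  assert (- tan K <= v).
  { destruct (Rle_lt_dec (- tan K) v) as [|G]; [assumption|exfalso].
    apply atan_increasing in G. rewrite atan_opp in G. lra. }
  split; nra. }
assert (C0 := CXY t0 ltac:(lra)). destruct C0 as [CX CY].
assert (CK : continuity_pt (fun t => tan K * X t) t0).
{ apply continuity_pt_mult; [apply continuity_pt_const; intros ? ?; reflexivity|exact CX]. }
assert (B1 : 0 <= tan K * X t0 - Y t0).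
{ apply (nonneg_left_limit (fun t => tan K * X t - Y t)); [lra| |].
  - apply continuity_pt_minus; assumption.
  - intros t Ht. assert (T := TB t Ht). lra. }
assert (B2 : 0 <= tan K * X t0 + Y t0).
{ apply (nonneg_left_limit (fun t => tan K * X t + Y t)); [lra| |].
  - apply continuity_pt_plus; assumption.
  - intros t Ht. assert (T := TB t Ht). lra. }
rewrite Zt0 in B1, B2.
apply (quot_id_neq_0 f (0 + RtoC t0 * z)%C HD (D1 t0 ltac:(lra))).
apply injective_projections; [exact Zt0|]. change (Y t0 = 0). lra.
Qed.

Lemma cdiff_Clog_quot_id (f w : C -> C) (z : C) :
  class_A f -> zdlog_defined f ->
  (forall u, Cmod u < 1 -> Cmod (w u) <= Cmod u) ->
  (forall u, Cmod u < 1 -> zdlog f u = (1 + Casinh (w u))%C) ->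
  Cmod z < 1 -> z <> 0%C ->
  cdiff (fun u => Clog (quot_id f u)) z ((zdlog f z - 1) / z)%C.
Proof.
intros HA HD Hw Hp Hz N. eapply cdiff_val.
- apply (cdiff_comp Clog (quot_id f)); [apply cdiff_Clog, (quot_id_half_plane f w); assumption|].
  apply cdiff_quot_id; assumption.
- field. split; [exact N|apply quot_id_neq_0; assumption].
Qed.

(* In the coordinate zeta = log z the function log f has derivative z f'/f, of
   positive real part, on the (convex) left half-plane; and equality of the
   values of f lifts to equality of the values of log f. *)
Lemma subordinate_asinh_univalent (f w : C -> C) (z1 z2 : C) :
  class_A f -> zdlog_defined f ->
  (forall u, Cmod u < 1 -> Cmod (w u) <= Cmod u) ->
  (forall u, Cmod u < 1 -> zdlog f u = (1 + Casinh (w u))%C) ->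
  Cmod z1 < 1 -> Cmod z2 < 1 -> f z1 = f z2 -> z1 = z2.
Proof.
intros HA HD Hw Hp H1 H2 E. destruct (class_A_at_0 f HA) as [F0 _].
destruct (Ceq_dec z1 0) as [->|N1].
{ destruct (Ceq_dec z2 0) as [->|N2]; [reflexivity|].
  exfalso. apply (HD z2 H2 N2). rewrite <- E. exact F0. }
destruct (Ceq_dec z2 0) as [->|N2].
{ exfalso. apply (HD z1 H1 N1). rewrite E. exact F0. }
set (L := fun u => Clog (quot_id f u)).
assert (EL : forall z, Cmod z < 1 -> Cexp (L z) = quot_id f z).
{ intros z Hz. apply Clog_principal, quot_id_neq_0; assumption. }
(* a + d is the logarithm of z2, possibly not the principal one, for which log f, that is zeta +
   [L (Cexp zeta)], takes the same value as at a. *)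
set (a := Clog z1). set (d := (L z1 - L z2)%C).
assert (E1 : Cexp a = z1) by (apply Clog_principal, N1).
assert (E2 : Cexp (a + d) = z2).
{ unfold d. unfold Cminus. rewrite !Cexp_plus, Cexp_opp, E1, !EL by assumption.
  assert (Q2 := quot_id_neq_0 f z2 HD H2).
  rewrite (quot_id_mult f z1 F0), (quot_id_mult f z2 F0) in E.
  replace (z1 * (quot_id f z1 * / quot_id f z2))%C with (z1 * quot_id f z1 / quot_id f z2)%C
    by (field; exact Q2).
  rewrite E. field. exact Q2. }
destruct (Ceq_dec d 0) as [D0|D0].
{ rewrite <- E1, <- E2, D0. f_equal. ring. }
exfalso.
assert (R1 : Re a < 0).
{ apply exp_lt_inv. rewrite <- Cmod_Cexp, E1, exp_0. exact H1. }
assert (R2 : Re (a + d)%C < 0).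
{ apply exp_lt_inv. rewrite <- Cmod_Cexp, E2, exp_0. exact H2. }
(* On the segment Re zeta is a convex combination of two negative numbers. *)
assert (DI : forall t, 0 <= t <= 1 -> Cmod (Cexp (a + RtoC t * d)) < 1).
{ intros t Ht. rewrite Cmod_Cexp, <- exp_0. apply exp_increasing.
  replace (Re (a + RtoC t * d)%C) with ((1 - t) * Re a + t * Re (a + d)%C)
    by (unfold Re; simpl; ring).
  destruct (Req_dec t 0) as [->|]; [lra|]. nra. }
(* The factor conj d makes the derivative of G along d equal to |d|^2 p, of positive real part, as
   in the Noshiro-Warschawski theorem; equal end values then contradict the mean value theorem. *)
set (G := fun zeta => (Cconj d * (zeta + L (Cexp zeta)))%C).
assert (DG : forall t, 0 <= t <= 1 -> cdiff G (a + RtoC t * d)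
  (Cconj d * zdlog f (Cexp (a + RtoC t * d)))%C).
{ intros t Ht. set (zt := (a + RtoC t * d)%C).
  assert (I := DI t Ht). fold zt in I. assert (Nz := Cexp_neq_0 zt).
  assert (K1 := cdiff_comp L Cexp zt _ _ (cdiff_Clog_quot_id f w _ HA HD Hw Hp I Nz) (cdiff_Cexp zt)).
  assert (K2 := cdiff_plus _ _ zt _ _ (cdiff_id zt) K1).
  assert (K3 := cdiff_mult _ _ zt _ _ (cdiff_const (Cconj d) zt) K2).
  eapply cdiff_val; [exact K3|]. cbv beta. field. exact Nz. }
destruct (MVT_gen (fun t => Re (G (a + RtoC t * d)%C)) 0 1
  (fun t => Re (Cconj d * zdlog f (Cexp (a + RtoC t * d)) * d)%C)) as [c [Hc M]].
- intros t. rewrite Rmin_left, Rmax_right by lra. intros Ht.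
  apply is_derive_Re_line, DG. lra.
- intros t. rewrite Rmin_left, Rmax_right by lra. intros Ht.
  apply continuity_Re_Im_line. eapply cdiff_ccont, DG, Ht.
- rewrite Rmin_left, Rmax_right in Hc by lra.
  assert (EG : G (a + RtoC 1 * d)%C = G (a + RtoC 0 * d)%C).
  { unfold G. replace (a + RtoC 1 * d)%C with (a + d)%C by ring.
    replace (a + RtoC 0 * d)%C with a by ring. rewrite E1, E2. unfold d at 2. ring. }
  rewrite EG in M.
  assert (I := DI c Hc). rewrite (Hp _ I) in M.
  assert (S := Re_Casinh_gt_m1 _ (Rle_lt_trans _ _ _ (Hw _ I) I)).
  set (s := Casinh (w (Cexp (a + RtoC c * d)%C))) in *.
  assert (X : Re (Cconj d * (1 + s) * d)%C = (1 + Re s) * (Cmod d * Cmod d)).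
  { rewrite Cmod_sqr. unfold Re, Im. simpl. ring. }
  rewrite X in M. assert (PD : 0 < Cmod d) by (apply Cmod_gt_0, D0).
  assert (0 < (1 + Re s) * (Cmod d * Cmod d)) by (apply Rmult_lt_0_compat; nra). lra.
Qed.

(** * The three radii *)

Definition rescale (r : R) (f : C -> C) (z : C) : C := (/ RtoC r * f (RtoC r * z))%C.

Lemma RtoC_neq_0 (r : R) : r <> 0 -> RtoC r <> 0%C.
Proof. intros H E. injection E. exact H. Qed.

Lemma Cmod_scale (r : R) (z : C) : 0 < r -> Cmod (RtoC r * z) = r * Cmod z.
Proof. intros Hr. rewrite Cmod_mult, Cmod_R, Rabs_pos_eq; lra. Qed.

Lemma Cmod_scale_lt (r : R) (z : C) : 0 < r <= 1 -> Cmod z < 1 -> Cmod (RtoC r * z) < 1.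
Proof. intros Hr Hz. rewrite Cmod_scale by lra. assert (P := Cmod_ge_0 z). nra. Qed.

Lemma cdiff_scale (r : R) (z : C) : cdiff (fun u => RtoC r * u)%C z (RtoC r).
Proof.
eapply cdiff_val; [apply (cdiff_mult (fun _ => RtoC r) (fun u => u)); [apply cdiff_const|apply cdiff_id]|].
ring.
Qed.

Lemma cdiff_rescale (r : R) (f : C -> C) (z l : C) : r <> 0 ->
  cdiff f (RtoC r * z) l -> cdiff (rescale r f) z l.
Proof.
intros Hr H. apply RtoC_neq_0 in Hr.
eapply cdiff_val.
- apply (cdiff_mult (fun _ => / RtoC r)%C (fun u => f (RtoC r * u)%C)); [apply cdiff_const|].
  apply (cdiff_comp f (fun u => RtoC r * u)%C); [exact H|apply cdiff_scale].
- cbv beta. field. exact Hr.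
Qed.

Lemma class_A_rescale (r : R) (f : C -> C) : 0 < r <= 1 -> class_A f -> class_A (rescale r f).
Proof.
intros Hr HA. assert (N : RtoC r <> 0%C) by (apply RtoC_neq_0; lra). split.
- intros z Hz. eapply cdiff_ex_derive, cdiff_rescale; [lra|].
  apply class_A_cdiff; [exact HA|apply Cmod_scale_lt; assumption].
- destruct HA as [_ [a [A0 [A1 H]]]].
  exists (fun n => (/ RtoC r * (a n * RtoC r ^ n))%C). split; [rewrite A0; ring|].
  split; [rewrite A1, Cpow_1_r; field; exact N|].
  intros z Hz.
  assert (S := proj1 (is_pseries_cps a _ _) (H _ (Cmod_scale_lt r z Hr Hz))).
  apply (is_series_scal (V := C_NormedModule) (/ RtoC r)%C) in S.
  apply (proj2 (is_pseries_cps _ z _)).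
  revert S. apply is_series_C_ext. intros n.
  change (/ RtoC r * (a n * (RtoC r * z) ^ n) = / RtoC r * (a n * RtoC r ^ n) * z ^ n)%C.
  rewrite Cpow_mult_l. ring.
Qed.

Lemma zdlog_defined_rescale (r : R) (f : C -> C) :
  0 < r <= 1 -> zdlog_defined f -> zdlog_defined (rescale r f).
Proof.
intros Hr HD z Hz N E. assert (Nr : RtoC r <> 0%C) by (apply RtoC_neq_0; lra).
apply (HD (RtoC r * z)%C); [apply Cmod_scale_lt; assumption|apply Cmult_neq_0; assumption|].
replace (f (RtoC r * z)%C) with (RtoC r * rescale r f z)%C by (unfold rescale; field; exact Nr).
rewrite E. ring.
Qed.

Lemma zdlog_rescale (r : R) (f : C -> C) (z : C) :
  0 < r <= 1 -> class_A f -> zdlog_defined f -> Cmod z < 1 ->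
  zdlog (rescale r f) z = zdlog f (RtoC r * z).
Proof.
intros Hr HA HD Hz. assert (Nr : RtoC r <> 0%C) by (apply RtoC_neq_0; lra).
unfold zdlog. destruct (Ceq_dec z 0) as [->|N].
- destruct (Ceq_dec _ _) as [|M]; [reflexivity|]. exfalso. apply M. ring.
- assert (N' : (RtoC r * z)%C <> 0%C) by (apply Cmult_neq_0; assumption).
  destruct (Ceq_dec _ _) as [|_]; [contradiction|].
  assert (Hz' := Cmod_scale_lt r z Hr Hz).
  assert (NF := HD _ Hz' N').
  rewrite (cdiff_C_derive (rescale r f) z (C_derive f (RtoC r * z)%C)).
  + unfold rescale. field. split; assumption.
  + apply cdiff_rescale; [lra|]. apply class_A_cdiff; assumption.
Qed.

Lemma S_rho_univalent (f : C -> C) : class_S_rho f ->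
  forall z1 z2, Cmod z1 < 1 -> Cmod z2 < 1 -> f z1 = f z2 -> z1 = z2.
Proof.
intros [HA [HD [w [_ [_ [Hw Hp]]]]]].
intros z1 z2. exact (subordinate_asinh_univalent f w z1 z2 HA HD Hw Hp).
Qed.

Lemma class_S_rescale (r : R) (f : C -> C) : 0 < r <= 1 -> class_S_rho f -> class_S (rescale r f).
Proof.
intros Hr HS. split; [apply class_A_rescale; [exact Hr|apply HS]|].
intros z1 z2 H1 H2 E. assert (Nr : RtoC r <> 0%C) by (apply RtoC_neq_0; lra).
assert (K : forall u v : C, (/ RtoC r * u = / RtoC r * v)%C -> u = v).
{ intros u v H. replace u with (RtoC r * (/ RtoC r * u))%C by (field; exact Nr).
  rewrite H. field. exact Nr. }
assert (X := S_rho_univalent f HS _ _ (Cmod_scale_lt r _ Hr H1) (Cmod_scale_lt r _ Hr H2) (K _ _ E)).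
replace z1 with (/ RtoC r * (RtoC r * z1))%C by (field; exact Nr).
rewrite X. field. exact Nr.
Qed.

(** Guarantees 1 - alpha <= 1, the range in which the half-plane inequality is proved. *)
Lemma arcsinh_1_le : arcsinh 1 <= 1.
Proof.
assert (H := arcsinh_le 1 (sinh 1) (sinh_ge_id 1 Rle_0_1)). rewrite arcsinh_sinh in H. exact H.
Qed.

Lemma Re_asinh_rescale (w : C -> C) (r d : R) (z : C) :
  (forall z, Cmod z < 1 -> Cmod (w z) <= Cmod z) ->
  0 < r <= 1 -> 0 < d -> r <= sinh d -> Cmod z < 1 ->
  Cmod (w (RtoC r * z)%C) <= r * Cmod z /\ Cmod (w (RtoC r * z)%C) < r /\
  Cmod (w (RtoC r * z)%C) < 1 /\ Rabs (Re (Casinh (w (RtoC r * z)%C))) < d.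
Proof.
intros Hw Hr Hd Hrd Hz. assert (P := Cmod_ge_0 z).
assert (B := Hw _ (Cmod_scale_lt r z Hr Hz)). rewrite Cmod_scale in B by lra.
assert (B2 : r * Cmod z < r) by nra.
split; [exact B|]. split; [lra|]. split; [lra|]. apply Re_Casinh_bound; lra.
Qed.

Lemma radius_S_star (f : C -> C) (alpha : R) : class_S_rho f ->
  1 - arcsinh 1 <= alpha < 1 -> in_disc (class_S_star alpha) f (sinh (1 - alpha)).
Proof.
intros HS Ha r H0 H1 H2. fold (rescale r f). assert (Hr : 0 < r <= 1) by lra.
set (d := 1 - alpha) in *. assert (A1 := arcsinh_1_le).
assert (Hd : 0 < d <= 1) by (unfold d; lra).
split; [apply class_S_rescale; assumption|].
destruct HS as [HA [HD [w [Aw [W0 [Hw Hp]]]]]].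
split; [apply zdlog_defined_rescale; assumption|].
set (s := fun z => Casinh (w (RtoC r * z)%C)).
assert (Hs : forall z, Cmod z < 1 -> (s z + RtoC (2 * d))%C <> 0%C).
{ intros z Hz. destruct (Re_asinh_rescale w r d z Hw Hr (proj1 Hd) H1 Hz) as [_ [_ [_ B]]].
  apply Rabs_lt_between in B. apply Re_pos_neq_0.
  change (0 < Re (s z) + 2 * d). unfold s. lra. }
(* The solution v of 1 + s = (1 + (1 - 2 alpha) v) / (1 - v). *)
exists (fun z => s z / (s z + RtoC (2 * d)))%C.
split; [|split; [|split]].
- intros z Hz. destruct (Re_asinh_rescale w r d z Hw Hr (proj1 Hd) H1 Hz) as [_ [_ [B _]]].
  assert (Dw := ex_derive_cdiff w _ (Aw _ (Cmod_scale_lt r z Hr Hz))).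
  assert (D1 := cdiff_comp w (fun u => RtoC r * u)%C z _ _ Dw (cdiff_scale r z)).
  assert (D2 := cdiff_comp Casinh (fun u => w (RtoC r * u)%C) z _ _ (cdiff_Casinh _ B) D1).
  assert (D3 := cdiff_plus s _ z _ _ D2 (cdiff_const (RtoC (2 * d)) z)).
  exact (cdiff_ex_derive _ _ _ (cdiff_div s _ z _ _ D2 D3 (Hs z Hz))).
- unfold s. rewrite Cmult_0_r, W0, Casinh_0. unfold Cdiv. apply Cmult_0_l.
- intros z Hz. destruct (Re_asinh_rescale w r d z Hw Hr (proj1 Hd) H1 Hz) as [B1 [_ [B2 B3]]].
  assert (N := Hs z Hz). rewrite Cmod_div by exact N.
  set (sz := s z) in *. assert (N' := proj1 (Cmod_gt_0 _) N).
  apply Rmult_le_reg_r with (Cmod (sz + RtoC (2 * d))); [exact N'|].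
  unfold Rdiv. rewrite Rmult_assoc, Rinv_l, Rmult_1_r by lra.
  destruct (Casinh_spec _ B2) as [BI _].
  assert (KEY := half_plane_key (Re sz) (Im sz) d Hd).
  assert (EM := Casinh_mod _ B2). fold (s z) in EM, B3, BI. fold sz in EM, B3, BI.
  apply Rabs_lt_between in B3.
  assert (KEY' := KEY ltac:(lra) ltac:(lra)). clear KEY. rewrite EM in KEY'.
  rewrite <- Cmod_sqr in KEY'.
  replace ((Re sz + 2 * d) * (Re sz + 2 * d) + Im sz * Im sz)
    with (Cmod (sz + RtoC (2 * d)) * Cmod (sz + RtoC (2 * d))) in KEY'
    by (rewrite Cmod_sqr; unfold Re, Im; simpl; ring).
  set (W := Cmod (w (RtoC r * z)%C)) in *.
  assert (W1 : 0 <= W) by apply Cmod_ge_0. assert (Z := Cmod_ge_0 z).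
  assert (W2 : W <= sinh d * Cmod z) by nra.
  assert (SP : 0 < sinh d) by (assert (T := sinh_ge_id d); lra).
  set (m := Cmod (sz + RtoC (2 * d))) in *. assert (Q := Cmod_ge_0 sz). set (n := Cmod sz) in *.
  apply Rmult_le_reg_r with (sinh d); [exact SP|].
  (* The square of |s| sinh d <= |w(r z)| |s + 2 d|; combined with |w(r z)| <= |z| sinh d, sinh d
     cancels. *)
  assert (Sq : (n * sinh d) * (n * sinh d) <= (W * m) * (W * m)) by nra.
  assert (n * sinh d <= W * m).
  { apply Rsqr_incr_0; [unfold Rsqr; exact Sq|nra|nra]. }
  nra.
- intros z Hz. rewrite zdlog_rescale by assumption.
  rewrite (Hp _ (Cmod_scale_lt r z Hr Hz)). fold (s z).
  assert (N := Hs z Hz). set (sz := s z) in *.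
  replace (RtoC (1 - 2 * alpha)) with (RtoC (2 * d) - 1)%C
    by (rewrite <- RtoC_minus; f_equal; unfold d; ring).
  assert (N2 : RtoC (2 * d) <> 0%C) by (apply RtoC_neq_0; lra).
  field. split; [exact N|]. intros E. apply N2. rewrite <- E. ring.
Qed.

Lemma radius_M (f : C -> C) (beta : R) : class_S_rho f ->
  1 < beta -> in_disc (class_M beta) f (sinh (beta - 1)).
Proof.
intros [HA [HD [w [Aw [W0 [Hw Hp]]]]]] Hb r H0 H1 H2. fold (rescale r f).
assert (Hr : 0 < r <= 1) by lra.
split; [apply class_A_rescale; assumption|]. split; [apply zdlog_defined_rescale; assumption|].
intros z Hz. rewrite zdlog_rescale, (Hp _ (Cmod_scale_lt r z Hr Hz)) by assumption.
destruct (Re_asinh_rescale w r (beta - 1) z Hw Hr) as [_ [_ [_ B]]]; [lra|exact H1|exact Hz|].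
apply Rabs_lt_between in B. change (1 + Re (Casinh (w (RtoC r * z)%C)) < beta). lra.
Qed.

Lemma radius_kST (f : C -> C) (k : R) : class_S_rho f ->
  0 < k -> in_disc (class_kST k) f (sinh (1 / (k + 1))).
Proof.
intros [HA [HD [w [Aw [W0 [Hw Hp]]]]]] Hk r H0 H1 H2. fold (rescale r f).
assert (Hr : 0 < r <= 1) by lra.
split; [apply class_A_rescale; assumption|]. split; [apply zdlog_defined_rescale; assumption|].
intros z Hz. rewrite zdlog_rescale, (Hp _ (Cmod_scale_lt r z Hr Hz)) by assumption.
set (d := 1 / (k + 1)) in *.
assert (Hd : 0 < d) by (unfold d; apply Rdiv_lt_0_compat; lra).
destruct (Re_asinh_rescale w r d z Hw Hr Hd H1 Hz) as [_ [B1 [B2 B3]]].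
assert (BR := Re_Casinh_gt_m1 _ B2).
destruct (Casinh_spec _ B2) as [BI _]. assert (EM := Casinh_mod _ B2).
set (W := Cmod (w (RtoC r * z)%C)) in *. set (s := Casinh (w (RtoC r * z)%C)) in *.
replace (1 + s - 1)%C with s by ring.
change (1 + Re s > k * Cmod s).
assert (W1 : 0 <= W) by apply Cmod_ge_0.
(* [conic_key] is not strict whereas [class_kST] is. A point m strictly between |w(r z)| and r gives
   e = arcsinh m < d, hence k e < 1 - e strictly. *)
set (m := (W + r) / 2). set (e := arcsinh m).
assert (Em : sinh e = m) by apply sinh_arcsinh.
assert (E0 : 0 < e) by (unfold e; rewrite <- arcsinh_0; apply arcsinh_lt; unfold m; lra).
assert (E1 : e <= 1).
{ apply Rle_trans with (arcsinh 1); [|apply arcsinh_1_le]. apply arcsinh_le. unfold m. lra. }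
assert (Ed : e < d).
{ unfold e. rewrite <- (arcsinh_sinh d). apply arcsinh_lt. unfold m. lra. }
assert (Kd : (k + 1) * d = 1) by (unfold d; field; lra).
assert (Ke : k * e < 1 - e) by nra.
assert (KEY := conic_key (Re s) (Im s) e (conj E0 E1) ltac:(lra)).
rewrite EM, Em, <- Cmod_sqr in KEY.
assert (KEY' : (1 - e) * (1 - e) * (Cmod s * Cmod s) <= e * e * ((1 + Re s) * (1 + Re s))).
{ apply KEY. unfold m. nra. }
assert (Q := Cmod_ge_0 s). set (n := Cmod s) in *.
assert (L : (1 - e) * n <= e * (1 + Re s)).
{ apply Rsqr_incr_0; [unfold Rsqr; lra|nra|nra]. }
(* The strict gain is multiplied by |s|, so s = 0 is treated apart. *)
destruct Q as [Q|Q].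
- assert (k * e * n < (1 - e) * n) by (apply Rmult_lt_compat_r; assumption).
  assert (e * (k * n) < e * (1 + Re s)) by lra.
  apply Rmult_lt_reg_l in H3; lra.
- rewrite <- Q. lra.
Qed.

(** * The extremal function *)

(* Maclaurin coefficients of (1 + z^2)^(-1/2), the derivative of asinh. *)
Fixpoint dasinh_coef (n : nat) : R :=
  match n with
  | O => 1
  | S O => 0
  | S (S m) => - (INR (S m) / INR (S (S m))) * dasinh_coef m
  end.

(* asinh z = z * sum (asinh_quot_coef n) z^n *)
Definition asinh_quot_coef (n : nat) : R := dasinh_coef n / INR (S n).

(* For E' = asinh z / z and q = exp E, the identity q' = E' q reads
   (n + 1) q_(n+1) = sum_(k <= n) asinh_quot_coef k * q_(n-k). *)
Fixpoint extremal_prefix (n : nat) : nat -> R :=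
  match n with
  | O => fun _ => 1
  | S m => fun j => if (j <=? m)%nat then extremal_prefix m j else
      sum_n (fun k => asinh_quot_coef k * extremal_prefix m (m - k)%nat) m / INR (S m)
  end.

(** The recurrence refers to all earlier coefficients, so structural recursion builds a table of the
    first n + 1 of them, and the diagonal is read off. *)
Definition extremal_coef (n : nat) : R := extremal_prefix n n.

Lemma dasinh_coef_bound (n : nat) : Rabs (dasinh_coef n) <= 1.
Proof.
(* The recursion has step two, so two consecutive bounds are carried along. *)
assert (H : Rabs (dasinh_coef n) <= 1 /\ Rabs (dasinh_coef (S n)) <= 1); [|apply H].
induction n as [|n [IH1 IH2]].
- simpl. rewrite Rabs_R1, Rabs_R0. lra.
- split; [exact IH2|].
  change (Rabs (- (INR (S n) / INR (S (S n))) * dasinh_coef n) <= 1).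
  rewrite Rabs_mult, Rabs_Ropp.
  assert (P := pos_INR (S n)). rewrite (S_INR (S n)).
  assert (Q : 0 <= INR (S n) / (INR (S n) + 1) <= 1).
  { split; [apply Rmult_le_pos; [exact P|left; apply Rinv_0_lt_compat; lra]|].
    apply Rmult_le_reg_r with (INR (S n) + 1); [lra|].
    unfold Rdiv. rewrite Rmult_assoc, Rinv_l by lra. lra. }
  rewrite Rabs_pos_eq by lra. assert (R0 := Rabs_pos (dasinh_coef n)). nra.
Qed.

Lemma asinh_quot_coef_bound (n : nat) : Rabs (asinh_quot_coef n) <= 1.
Proof.
unfold asinh_quot_coef, Rdiv. rewrite Rabs_mult, Rabs_inv.
assert (B := dasinh_coef_bound n). assert (P := pos_INR n).
rewrite (Rabs_pos_eq (INR (S n))) by apply pos_INR. rewrite S_INR.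
assert (Q : 0 < / (INR n + 1) <= 1).
{ split; [apply Rinv_0_lt_compat; lra|]. rewrite <- Rinv_1. apply Rinv_le_contravar; lra. }
assert (R0 := Rabs_pos (dasinh_coef n)). nra.
Qed.

Lemma extremal_prefix_stable (n m j : nat) :
  (j <= n <= m)%nat -> extremal_prefix m j = extremal_prefix n j.
Proof.
intros [H1 H2]. induction H2 as [|m H2 IH]; [reflexivity|].
simpl. destruct (Nat.leb_spec j m) as [_|L]; [exact IH|lia].
Qed.

Lemma extremal_coef_rec (n : nat) :
  INR (S n) * extremal_coef (S n) =
  sum_n (fun k => asinh_quot_coef k * extremal_coef (n - k)%nat) n.
Proof.
unfold extremal_coef at 1. cbn [extremal_prefix].
destruct (Nat.leb_spec (S n) n) as [L|_]; [lia|].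
rewrite (sum_n_ext_loc _ (fun k => asinh_quot_coef k * extremal_coef (n - k)%nat)).
- field. apply not_0_INR. lia.
- intros k Hk. unfold extremal_coef.
  rewrite (extremal_prefix_stable (n - k) n (n - k)) by lia. reflexivity.
Qed.

Lemma Rabs_sum_n_le (u : nat -> R) (n : nat) :
  (forall k, (k <= n)%nat -> Rabs (u k) <= 1) -> Rabs (sum_n u n) <= INR (S n).
Proof.
induction n as [|n IH]; intros H.
- rewrite sum_O. simpl. apply H. lia.
- rewrite sum_Sn, (S_INR (S n)). eapply Rle_trans; [apply Rabs_triang|].
  apply Rplus_le_compat; [apply IH; intros k Hk; apply H; lia|apply H; lia].
Qed.

(** The recurrence makes (n + 1) q_(n+1) a sum of n + 1 products of modulus at most 1. *)
Lemma extremal_coef_bound (n : nat) : Rabs (extremal_coef n) <= 1.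
Proof.
induction n as [n IH] using (well_founded_induction Wf_nat.lt_wf).
destruct n as [|n].
- unfold extremal_coef. simpl. rewrite Rabs_R1. lra.
- assert (E := extremal_coef_rec n). assert (P := pos_INR n).
  assert (B : Rabs (INR (S n) * extremal_coef (S n)) <= INR (S n)).
  { rewrite E. apply Rabs_sum_n_le. intros k Hk. rewrite Rabs_mult.
    assert (B1 := asinh_quot_coef_bound k). assert (B2 := IH (n - k)%nat ltac:(lia)).
    assert (Q1 := Rabs_pos (asinh_quot_coef k)). nra. }
  rewrite Rabs_mult, (Rabs_pos_eq (INR (S n))) in B by apply pos_INR.
  rewrite S_INR in B. apply Rmult_le_reg_l with (INR n + 1); lra.
Qed.

Lemma disc_conv_real (c : nat -> R) : (forall n, Rabs (c n) <= 1) ->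
  disc_conv (fun n => RtoC (c n)).
Proof. intros H. apply disc_conv_of_coef_bounded with 1. intros n. rewrite Cmod_R. apply H. Qed.

Definition dasinh (z : C) : C := csum (fun n => RtoC (dasinh_coef n)) z.
Definition asinh_quot (z : C) : C := csum (fun n => RtoC (asinh_quot_coef n)) z.
Definition extremal_quot (z : C) : C := csum (fun n => RtoC (extremal_coef n)) z.

Lemma dasinh_cps (z : C) : Cmod z < 1 -> cps (fun n => RtoC (dasinh_coef n)) z (dasinh z).
Proof. apply csum_cps, disc_conv_real, dasinh_coef_bound. Qed.

Lemma asinh_quot_cps (z : C) : Cmod z < 1 -> cps (fun n => RtoC (asinh_quot_coef n)) z (asinh_quot z).
Proof. apply csum_cps, disc_conv_real, asinh_quot_coef_bound. Qed.

Lemma extremal_quot_cps (z : C) : Cmod z < 1 -> cps (fun n => RtoC (extremal_coef n)) z (extremal_quot z).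
Proof. apply csum_cps, disc_conv_real, extremal_coef_bound. Qed.

Lemma cps_ext (a b : nat -> C) (z l : C) : (forall n, a n = b n) -> cps a z l -> cps b z l.
Proof. intros H. apply is_series_C_ext. intros n. rewrite H. reflexivity. Qed.

Lemma Cmod_0_lt_1 : Cmod (RtoC 0) < 1.
Proof. rewrite Cmod_0. lra. Qed.

(** For y = [dasinh], the recurrence (n + 2) c_(n+2) = - (n + 1) c_n says y' = - z (y + z y'), since
    (z y)' = y + z y' has coefficients (n + 1) c_n. *)
Lemma dasinh_ode (z : C) : Cmod z < 1 ->
  exists l, cdiff dasinh z l /\ ((1 + z * z) * l)%C = (- (z * dasinh z))%C.
Proof.
intros Hz. set (b := fun n => RtoC (dasinh_coef n)).
assert (DC : disc_conv b) by apply disc_conv_real, dasinh_coef_bound.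
exists (csum (cderiv_coef b) z). split; [apply csum_cdiff; assumption|].
set (l := csum (cderiv_coef b) z).
assert (S0 : cps (cderiv_coef b) z l) by (apply csum_cps; [apply disc_conv_deriv, DC|exact Hz]).
assert (S1 := cps_deriv_shift b z l S0).
assert (S2 := is_series_scal (V := C_NormedModule) z _ _ S1).
assert (S3 := is_series_plus _ _ _ _ (dasinh_cps z Hz) S2).
assert (S4 : cps (fun n => (- (RtoC (INR (S n)) * b n))%C) z (- (dasinh z + z * l))%C).
{ apply (is_series_opp (V := C_NormedModule)) in S3.
  revert S3. apply is_series_C_ext. intros n.
  change (- (b n * z ^ n + z * (RtoC (INR n) * b n * z ^ pred n)) =
    - (RtoC (INR (S n)) * b n) * z ^ n)%C.
  rewrite S_INR, RtoC_plus. destruct n as [|n]; [simpl; ring|].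
  simpl pred. rewrite Cpow_S. ring. }
assert (S5 : cps (cderiv_coef b) z (cderiv_coef b 0%nat + z * (- (dasinh z + z * l)))%C).
{ apply cps_decr_1. apply cps_ext with (2 := S4). intros n.
  unfold cderiv_coef, b. rewrite <- !RtoC_mult, <- RtoC_opp. f_equal.
  change (- (INR (S n) * dasinh_coef n) =
    INR (S (S n)) * (- (INR (S n) / INR (S (S n))) * dasinh_coef n)).
  field. apply not_0_INR. lia. }
assert (E := cps_unique _ _ _ _ S0 S5).
replace (cderiv_coef b 0%nat) with (RtoC 0) in E
  by (unfold cderiv_coef, b; simpl; ring).
replace ((1 + z * z) * l)%C with (l + z * z * l)%C by ring.
rewrite E at 1. ring.
Qed.

(** By the differential equation the product with [cosh_asinh] has derivative 0, and it is 1 at the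
    origin. *)
Lemma dasinh_eq (z : C) : Cmod z < 1 -> dasinh z = (/ cosh_asinh z)%C.
Proof.
intros Hz.
assert (K : forall u, Cmod u < 1 -> cdiff (fun v => dasinh v * cosh_asinh v)%C u 0%C).
{ intros u Hu. destruct (dasinh_ode u Hu) as [l [Dl El]].
  eapply cdiff_val; [apply (cdiff_mult dasinh cosh_asinh); [exact Dl|apply cdiff_cosh_asinh, Hu]|].
  assert (N := cosh_asinh_neq_0 u Hu). destruct (cosh_asinh_sqr u Hu) as [E _].
  set (T := cosh_asinh u) in *.
  replace (l * T + dasinh u * (u / T))%C with ((T * T * l + u * dasinh u) / T)%C by (field; exact N).
  rewrite E, El. field. exact N. }
assert (E := cdiff_zero_const _ K z Hz). cbv beta in E.
assert (B0 : dasinh 0 = 1%C).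
{ unfold dasinh. rewrite csum_0; [reflexivity|]. apply disc_conv_real, dasinh_coef_bound. }
assert (T0 : cosh_asinh 0 = 1%C).
{ assert (X := Cexp_Casinh 0 Cmod_0_lt_1). rewrite Casinh_0, Cexp_0 in X.
  rewrite X. ring. }
rewrite B0, T0 in E. assert (N := cosh_asinh_neq_0 z Hz).
replace (dasinh z) with (dasinh z * cosh_asinh z / cosh_asinh z)%C by (field; exact N).
rewrite E. field. exact N.
Qed.

(** Both sides vanish at 0 and have derivative [dasinh]. *)
Lemma Casinh_series (z : C) : Cmod z < 1 -> Casinh z = (z * asinh_quot z)%C.
Proof.
intros Hz.
set (c := fun n => match n with O => RtoC 0 | S m => RtoC (asinh_quot_coef m) end).
assert (DC : disc_conv c).
{ apply disc_conv_of_coef_bounded with 1. intros [|n]; unfold c; rewrite Cmod_R.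
  - rewrite Rabs_R0. lra.
  - apply asinh_quot_coef_bound. }
assert (S : forall u, Cmod u < 1 -> csum c u = (u * asinh_quot u)%C).
{ intros u Hu. apply (cps_unique c u); [apply csum_cps; assumption|].
  replace (u * asinh_quot u)%C with (c 0%nat + u * asinh_quot u)%C by (unfold c; ring).
  apply cps_decr_1. apply asinh_quot_cps, Hu. }
assert (D : forall u, Cmod u < 1 -> cdiff (csum c) u (dasinh u)).
{ intros u Hu. eapply cdiff_val; [apply csum_cdiff; assumption|].
  apply (cps_unique (cderiv_coef c) u); [apply csum_cps; [apply disc_conv_deriv, DC|exact Hu]|].
  apply cps_ext with (2 := dasinh_cps u Hu). intros n. unfold cderiv_coef, c, asinh_quot_coef.
  rewrite <- RtoC_mult. f_equal. field. apply not_0_INR. lia. }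
assert (K : forall u, Cmod u < 1 -> cdiff (fun v => csum c v + - (1) * Casinh v)%C u 0%C).
{ intros u Hu. eapply cdiff_val.
  - apply (cdiff_plus (csum c) (fun v => - (1) * Casinh v)%C); [apply D, Hu|].
    apply (cdiff_mult (fun _ => - (1))%C Casinh); [apply cdiff_const|apply cdiff_Casinh, Hu].
  - cbv beta. rewrite dasinh_eq by exact Hu. field. apply cosh_asinh_neq_0, Hu. }
assert (E := cdiff_zero_const _ K z Hz). cbv beta in E.
rewrite Casinh_0, (S 0%C Cmod_0_lt_1), (S z Hz) in E.
replace (Casinh z) with (z * asinh_quot z - (z * asinh_quot z + - (1) * Casinh z))%C by ring.
rewrite E. ring.
Qed.

Lemma cdiff_extremal_quot (z : C) : Cmod z < 1 ->
  cdiff extremal_quot z (asinh_quot z * extremal_quot z)%C.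
Proof.
intros Hz. set (q := fun n => RtoC (extremal_coef n)).
assert (DQ : disc_conv q) by apply disc_conv_real, extremal_coef_bound.
eapply cdiff_val; [apply csum_cdiff; [exact DQ|exact Hz]|].
apply (cps_unique (cderiv_coef q) z); [apply csum_cps; [apply disc_conv_deriv, DQ|exact Hz]|].
assert (M := cps_mult _ _ z _ _ (disc_conv_real _ asinh_quot_coef_bound) DQ Hz
  (asinh_quot_cps z Hz) (extremal_quot_cps z Hz)).
apply cps_ext with (2 := M). intros n. unfold cderiv_coef, q.
rewrite <- RtoC_mult, extremal_coef_rec.
apply injective_projections.
- change (Re (sum_n (fun k => (RtoC (asinh_quot_coef k) * RtoC (extremal_coef (n - k)%nat))%C) n) =
    sum_n (fun k => asinh_quot_coef k * extremal_coef (n - k)%nat) n).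
  rewrite Re_sum_n. apply sum_n_ext. intros k. unfold Re. simpl. ring.
- change (Im (sum_n (fun k => (RtoC (asinh_quot_coef k) * RtoC (extremal_coef (n - k)%nat))%C) n) = 0).
  rewrite Im_sum_n. rewrite (sum_n_ext _ (fun _ => 0)); [rewrite sum_n_const; ring|].
  intros k. unfold Im. simpl. ring.
Qed.

(** If E is the termwise primitive of [asinh_quot], then [extremal_quot] times exp (-E) has
    derivative 0 and value 1 at the origin, so it is never 0. This provides [zdlog_defined]. *)
Lemma extremal_quot_neq_0 (z : C) : Cmod z < 1 -> extremal_quot z <> 0%C.
Proof.
intros Hz.
set (e := fun n => match n with O => RtoC 0 | S m => RtoC (asinh_quot_coef m / INR (S m)) end).
assert (De : disc_conv e).
{ apply disc_conv_of_coef_bounded with 1. intros [|n]; unfold e; rewrite Cmod_R.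
  - rewrite Rabs_R0. lra.
  - unfold Rdiv. rewrite Rabs_mult, Rabs_inv.
    assert (B := asinh_quot_coef_bound n). assert (P := pos_INR n).
    rewrite (Rabs_pos_eq (INR (S n))) by apply pos_INR. rewrite S_INR.
    assert (Q : 0 < / (INR n + 1) <= 1).
    { split; [apply Rinv_0_lt_compat; lra|]. rewrite <- Rinv_1. apply Rinv_le_contravar; lra. }
    assert (R0 := Rabs_pos (asinh_quot_coef n)). nra. }
assert (D : forall u, Cmod u < 1 -> cdiff (csum e) u (asinh_quot u)).
{ intros u Hu. eapply cdiff_val; [apply csum_cdiff; assumption|].
  apply (cps_unique (cderiv_coef e) u); [apply csum_cps; [apply disc_conv_deriv, De|exact Hu]|].
  apply cps_ext with (2 := asinh_quot_cps u Hu). intros n. unfold cderiv_coef, e.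
  rewrite <- RtoC_mult. f_equal. field. apply not_0_INR. lia. }
assert (K : forall u, Cmod u < 1 ->
  cdiff (fun v => extremal_quot v * Cexp (- (1) * csum e v))%C u 0%C).
{ intros u Hu.
  assert (D1 := cdiff_mult (fun _ => - (1))%C (csum e) u _ _ (cdiff_const _ u) (D u Hu)).
  assert (D2 := cdiff_comp Cexp _ u _ _ (cdiff_Cexp _) D1).
  eapply cdiff_val; [exact (cdiff_mult _ _ u _ _ (cdiff_extremal_quot u Hu) D2)|].
  cbv beta. ring. }
assert (E := cdiff_zero_const _ K z Hz). cbv beta in E.
intros Z. rewrite Z in E.
assert (Q0 : extremal_quot 0 = 1%C).
{ unfold extremal_quot. rewrite csum_0; [reflexivity|]. apply disc_conv_real, extremal_coef_bound. }
rewrite Q0, Cmult_0_l, Cmult_1_l in E. apply (Cexp_neq_0 _ (eq_sym E)).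
Qed.

Definition extremal (z : C) : C := (z * extremal_quot z)%C.

Lemma cdiff_extremal (z : C) : Cmod z < 1 ->
  cdiff extremal z (extremal_quot z * (1 + Casinh z))%C.
Proof.
intros Hz. eapply cdiff_val.
- apply (cdiff_mult (fun u => u) extremal_quot); [apply cdiff_id|apply cdiff_extremal_quot, Hz].
- cbv beta. rewrite Casinh_series by exact Hz. ring.
Qed.

Lemma zdlog_extremal (z : C) : Cmod z < 1 -> zdlog extremal z = (1 + Casinh z)%C.
Proof.
intros Hz. unfold zdlog. destruct (Ceq_dec z 0) as [->|N]; [rewrite Casinh_0; ring|].
rewrite (cdiff_C_derive _ _ _ (cdiff_extremal z Hz)). unfold extremal.
field. split; [apply extremal_quot_neq_0, Hz|exact N].
Qed.

Lemma extremal_S_rho : class_S_rho extremal.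
Proof.
split; [|split].
- split; [intros z Hz; eapply cdiff_ex_derive, cdiff_extremal, Hz|].
  set (a := fun n => match n with O => RtoC 0 | S m => RtoC (extremal_coef m) end).
  exists a. split; [reflexivity|]. split; [reflexivity|]. intros z Hz.
  apply (proj2 (is_pseries_cps a z _)). unfold extremal.
  replace (z * extremal_quot z)%C with (a 0%nat + z * extremal_quot z)%C by (unfold a; ring).
  apply cps_decr_1. apply extremal_quot_cps, Hz.
- intros z Hz N. apply Cmult_neq_0; [exact N|apply extremal_quot_neq_0, Hz].
- exists (fun z => z). split; [|split; [reflexivity|split]].
  + intros z _. eapply cdiff_ex_derive, cdiff_id.
  + intros z _. apply Rle_refl.
  + exact zdlog_extremal.
Qed.

Lemma zdlog_extremal_rescale (r x : R) : 0 < r <= 1 -> Rabs x < 1 ->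
  zdlog (rescale r extremal) (RtoC x) = RtoC (1 + arcsinh (r * x)).
Proof.
intros Hr Hx. assert (Hz : Cmod (RtoC x) < 1) by (rewrite Cmod_R; exact Hx).
rewrite zdlog_rescale; [|exact Hr|apply extremal_S_rho|apply extremal_S_rho|exact Hz].
rewrite zdlog_extremal by (apply Cmod_scale_lt; assumption).
rewrite <- RtoC_mult, Casinh_real, RtoC_plus; [reflexivity|].
rewrite Rabs_mult, Rabs_pos_eq by lra. assert (P := Rabs_pos x). nra.
Qed.

(** * Sharpness *)

Lemma exists_scale_above (d r : R) : 0 < d -> sinh d < r ->
  exists x, 0 < x < 1 /\ d < arcsinh (r * x).
Proof.
intros Hd Hr. assert (S : 0 < sinh d) by (assert (T := sinh_ge_id d); lra).
(* Chosen so that r x is the midpoint of sinh d and r. *)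
set (x := (sinh d + r) / (2 * r)).
assert (E : r * x = (sinh d + r) / 2) by (unfold x; field; lra).
exists x. split.
- split; [unfold x; apply Rdiv_lt_0_compat; lra|].
  apply Rmult_lt_reg_l with r; [lra|]. lra.
- rewrite <- (arcsinh_sinh d) at 1. apply arcsinh_lt. rewrite E. lra.
Qed.

Lemma arcsinh_opp (x : R) : arcsinh (- x) = - arcsinh x.
Proof. rewrite <- (arcsinh_sinh (- arcsinh x)), sinh_opp, sinh_arcsinh. reflexivity. Qed.

(** The real part equals alpha + (1 - alpha)(1 - |z|^2) / |1 - z|^2. *)
Lemma half_plane_map (alpha : R) (z : C) : alpha < 1 -> Cmod z < 1 ->
  alpha < Re ((1 + RtoC (1 - 2 * alpha) * z) / (1 - z))%C.
Proof.
intros Ha Hz. assert (S := Cmod_sqr z). assert (P := Cmod_ge_0 z).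
assert (S1 : Re z * Re z + Im z * Im z < 1) by nra.
destruct z as [x y]. unfold Re, Im in *. simpl in *.
set (D := (1 + - x) * ((1 + - x) * 1) + (0 + - y) * ((0 + - y) * 1)).
assert (PD : 0 < D) by (unfold D; nra).
match goal with |- alpha < ?e => replace e with (alpha + (1 - alpha) * (1 - (x * x + y * y)) / D) end.
- assert (0 < (1 - alpha) * (1 - (x * x + y * y)) / D); [|lra].
  apply Rdiv_lt_0_compat; [apply Rmult_lt_0_compat; lra|exact PD].
- assert (D <> 0) by lra. unfold D in *. field. intros e. apply H. lra.
Qed.

(** At z = -x the rescaled extremal function has p = 1 - arcsinh (r x) < alpha, outside the
    half-plane. *)
Lemma sharp_S_star (alpha : R) : alpha < 1 ->
  sharp_radius class_S_rho (class_S_star alpha) (sinh (1 - alpha)).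
Proof.
intros Ha r Hr H1 H.
destruct (exists_scale_above (1 - alpha) r) as [x [Hx A]]; [lra|exact Hr|].
destruct (H extremal extremal_S_rho r (proj1 H1) (Rle_refl r) (proj2 H1))
  as [_ [_ [w [_ [_ [W1 W2]]]]]]. fold (rescale r extremal) in W2.
assert (B : Rabs (- x) < 1) by (rewrite Rabs_Ropp, Rabs_pos_eq; lra).
assert (Hz : Cmod (RtoC (- x)) < 1) by (rewrite Cmod_R; exact B).
specialize (W1 _ Hz). specialize (W2 _ Hz).
rewrite zdlog_extremal_rescale in W2 by (assumption || lra).
assert (L := half_plane_map alpha (w (RtoC (- x))) Ha ltac:(lra)).
rewrite <- W2 in L. unfold Re in L. simpl in L.
replace (r * - x) with (- (r * x)) in L by ring. rewrite arcsinh_opp in L. lra.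
Qed.

(** At z = x one has p = 1 + arcsinh (r x) > beta. *)
Lemma sharp_M (beta : R) : 1 < beta ->
  sharp_radius class_S_rho (class_M beta) (sinh (beta - 1)).
Proof.
intros Hb r Hr H1 H.
destruct (exists_scale_above (beta - 1) r) as [x [Hx A]]; [lra|exact Hr|].
destruct (H extremal extremal_S_rho r (proj1 H1) (Rle_refl r) (proj2 H1)) as [_ [_ W]].
fold (rescale r extremal) in W.
assert (B : Rabs x < 1) by (rewrite Rabs_pos_eq; lra).
specialize (W (RtoC x)). rewrite Cmod_R in W. specialize (W B).
rewrite zdlog_extremal_rescale in W by (assumption || lra).
unfold Re in W. simpl in W. lra.
Qed.

(** At z = -x one has p = 1 - e with e = arcsinh (r x), and 1 - e > k e would mean e < 1/(k + 1). *)
Lemma sharp_kST (k : R) : 0 < k ->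
  sharp_radius class_S_rho (class_kST k) (sinh (1 / (k + 1))).
Proof.
intros Hk r Hr H1 H.
assert (Hd : 0 < 1 / (k + 1)) by (apply Rdiv_lt_0_compat; lra).
destruct (exists_scale_above (1 / (k + 1)) r) as [x [Hx A]]; [exact Hd|exact Hr|].
destruct (H extremal extremal_S_rho r (proj1 H1) (Rle_refl r) (proj2 H1)) as [_ [_ W]].
fold (rescale r extremal) in W.
assert (B : Rabs (- x) < 1) by (rewrite Rabs_Ropp, Rabs_pos_eq; lra).
specialize (W (RtoC (- x))). rewrite Cmod_R in W. specialize (W B).
rewrite zdlog_extremal_rescale in W by (assumption || lra).
replace (r * - x) with (- (r * x)) in W by ring. rewrite arcsinh_opp in W.
set (e := arcsinh (r * x)) in *.
replace (RtoC (1 + - e) - 1)%C with (RtoC (- e)) in W by (rewrite RtoC_plus; ring).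
rewrite Cmod_R, Rabs_Ropp, Rabs_pos_eq in W by lra.
unfold Re in W. simpl in W.
assert (K : (k + 1) * (1 / (k + 1)) = 1) by (field; lra).
assert ((k + 1) * (1 / (k + 1)) < (k + 1) * e) by (apply Rmult_lt_compat_l; lra). lra.
Qed.

Theorem theorem4p1 :
  (forall f : C -> C, class_S_rho f ->
     (forall alpha : R, 1 - arcsinh 1 <= alpha < 1 ->
        in_disc (class_S_star alpha) f (sinh (1 - alpha))) /\
     (forall beta : R, 1 < beta <= 1 + arcsinh 1 ->
        in_disc (class_M beta) f (sinh (beta - 1))) /\
     (forall k : R, 0 < k ->
        in_disc (class_kST k) f (sinh (1 / (k + 1))))) /\
  (forall alpha : R, 1 - arcsinh 1 <= alpha < 1 ->
     sharp_radius class_S_rho (class_S_star alpha) (sinh (1 - alpha))) /\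
  (forall beta : R, 1 < beta <= 1 + arcsinh 1 ->
     sharp_radius class_S_rho (class_M beta) (sinh (beta - 1))) /\
  (forall k : R, 0 < k ->
     sharp_radius class_S_rho (class_kST k) (sinh (1 / (k + 1)))).
Proof.
split; [|split; [|split]].
- intros f HS. split; [|split].
  + intros alpha Ha. apply radius_S_star; assumption.
  + intros beta Hb. apply radius_M; [exact HS|lra].
  + intros k Hk. apply radius_kST; assumption.
- intros alpha Ha. apply sharp_S_star. lra.
- intros beta Hb. apply sharp_M. lra.
- exact sharp_kST.
Qed.
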